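(* Let $\mathbb{F}$ be a field, let $(\mathsf{\Gamma},\mu,\eta)$ be the free divided power algebra monad on the category $\mathbb{F}\text{-}\mathsf{VEC}$ of $\mathbb{F}$-vector spaces, let $\partial_V:\mathsf{\Gamma}(V)\to\mathsf{\Gamma}(V\times V)$ be the linear map given on divided power monomials by $$\partial_V(v_1^{[r_1]}*\cdots*v_n^{[r_n]})=\sum_{i=1}^n(v_1,0)^{[r_1]}*\cdots*(v_i,0)^{[r_i-1]}*\cdots*(v_n,0)^{[r_n]}*(0,v_i)^{[1]}$$ (with the factor $(v_i,0)^{[r_i-1]}$ omitted when $r_i=1$), and let $\varepsilon_V:\mathsf{\Gamma}(V)\to V$ be the linear map with $\varepsilon_V(v_1^{[r_1]}*\cdots*v_n^{[r_n]})=v_1$ if $n=1$ and $r_1=1$, and $0$ otherwise. Then $(\mathsf{\Gamma},\mu,\eta,\partial)$ is a Cartesian differential comonad on $\mathbb{F}\text{-}\mathsf{VEC}^{op}$ with $\mathsf{D}$-linear unit $\varepsilon$. Therefore $\mathbb{F}\text{-}\mathsf{VEC}^{op}_{\mathsf{\Gamma}}$ is a Cartesian differential category and $\mathsf{D}\text{-}\mathsf{lin}[\mathbb{F}\text{-}\mathsf{VEC}^{op}_{\mathsf{\Gamma}}]\cong\mathbb{F}\text{-}\mathsf{VEC}^{op}$.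
   Context: The monad $\mathsf{\Gamma}$. For an $\mathbb{F}$-vector space $V$, $\mathsf{\Gamma}(V)=\bigoplus_{n\ge1}(V^{\otimes n})^{S(n)}$, the direct sum of the spaces of tensors invariant under the symmetric group $S(n)$; this is the free (non-unital) divided power algebra on $V$. For $v_1,\dots,v_n\in V$ and strictly positive integers $r_1,\dots,r_n$, the divided power monomial $v_1^{[r_1]}*\cdots*v_n^{[r_n]}$ is the element $$\sum_{\sigma\in S(r_1+\dots+r_n)/(S(r_1)\times\cdots\times S(r_n))}\sigma\cdot(v_1^{\otimes r_1}\otimes\cdots\otimes v_n^{\otimes r_n});$$ in particular $v^{[n]}=v^{\otimes n}$ and $v*w=v\otimes w+w\otimes v$. Such monomials span $\mathsf{\Gamma}(V)$ (not uniquely). For linear $f:V\to W$, $\mathsf{\Gamma}(f)(v_1^{[r_1]}*\cdots*v_n^{[r_n]})=f(v_1)^{[r_1]}*\cdots*f(v_n)^{[r_n]}$. The unit is $\eta_V(v)=v^{[1]}$. The multiplication $\mu_V:\mathsf{\Gamma}(\mathsf{\Gamma}(V))\to\mathsf{\Gamma}(V)$ is the linear map given on divided power monomials of divided power monomials by $$\mu_V\Big((v_{1,1}^{[q_{1,1}]}*\cdots*v_{1,k_1}^{[q_{1,k_1}]})^{[r_1]}*\cdots*(v_{p,1}^{[q_{p,1}]}*\cdots*v_{p,k_p}^{[q_{p,k_p}]})^{[r_p]}\Big)=\Big(\prod_{i=1}^p\frac{1}{r_i!}\prod_{j=1}^{k_i}\frac{(r_iq_{i,j})!}{(q_{i,j}!)^{r_i}}\Big)\,v_{1,1}^{[r_1q_{1,1}]}*\cdots*v_{1,k_1}^{[r_1q_{1,k_1}]}*\cdots*v_{p,k_p}^{[r_pq_{p,k_p}]},$$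 where the coefficient (an integer) is mapped to $\mathbb{F}$. It is known that $(\mathsf{\Gamma},\mu,\eta)$ is a well-defined monad on $\mathbb{F}\text{-}\mathsf{VEC}$. Dual notions. Let $(\mathsf{S},\mu,\eta)$ be a monad on a category $\mathbb{X}$ with finite biproducts $\times$ (projections $\pi_j$, injections $\iota_j$, diagonal $\Delta_V=\langle1_V,1_V\rangle$, copairing $[-,-]$, $c_V=\langle\pi_0\times\pi_0,\pi_1\times\pi_1\rangle$ on $(V\times V)\times(V\times V)$). A differential combinator transformation on it is a natural transformation $\partial_V:\mathsf{S}(V)\to\mathsf{S}(V\times V)$ with: [dc.1] $\mathsf{S}(\pi_0)\circ\partial_V=0$; [dc.2] $\mathsf{S}(1_V\times\Delta_V)\circ\partial_V=(\mathsf{S}(1_V\times\iota_0)+\mathsf{S}(1_V\times\iota_1))\circ\partial_V$; [dc.3] $\partial_V\circ\eta_V=\eta_{V\times V}\circ\iota_1$; [dc.4] $\partial_V\circ\mu_V=\mu_{V\times V}\circ\mathsf{S}([\mathsf{S}(\iota_0),\partial_V])\circ\partial_{\mathsf{S}(V)}$; [dc.5] $\mathsf{S}(\pi_0\times\pi_1)\circ\partial_{V\times V}\circ\partial_V=\partial_V$; [dc.6] $\mathsf{S}(c_V)\circ\partial_{V\times V}\circ\partial_V=\partial_{V\times V}\circ\partial_V$. Saying that $(\mathsf{S},\mu,\eta,\partial)$ is a Cartesian differential comonad on $\mathbb{X}^{op}$ means exactly this, and saying that a natural transformation $\varepsilon_V:\mathsf{S}(V)\to V$ is a $\mathsf{D}$-linear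 unit for it (on $\mathbb{X}^{op}$) means [du.1] $\varepsilon_V\circ\eta_V=1_V$ and [du.2] $\eta_V\circ\varepsilon_V=\mathsf{S}(\pi_1)\circ\partial_V$. The category $\mathbb{X}^{op}_{\mathsf{S}}$ is the opposite of the Kleisli category of $\mathsf{S}$ (the coKleisli category of the comonad on $\mathbb{X}^{op}$): objects as in $\mathbb{X}$; a map $A\to B$ is a map $f:B\to\mathsf{S}(A)$ of $\mathbb{X}$; the composite of $f:A\to B$ then $g:B\to C$ is $\mu_A\circ\mathsf{S}(f)\circ g:C\to\mathsf{S}(A)$; the identity is $\eta_A$. Its structure: sums and zeros of maps as in $\mathbb{X}$; product of $A,B$ is $A\times B$ with projections $\eta_{A\times B}\circ\iota_0$ and $\eta_{A\times B}\circ\iota_1$, pairing of $f:A\to\mathsf{S}(C)$ and $g:B\to\mathsf{S}(C)$ is the copairing $[f,g]$; the differential combinator sends $f:B\to\mathsf{S}(A)$ to $\mathsf{D}[f]=\partial_A\circ f:B\to\mathsf{S}(A\times A)$. Cartesian differential categories. A left additive category is a category whose hom-sets are commutative monoids such that $(f+g)\circ x=f\circ x+g\circ x$ and $0\circ x=0$; $f$ is additive if $f\circ(x+y)=f\circ x+f\circ y$ and $f\circ0=0$; a Cartesian left additive category is a left additive category with finite products whose projections are additive. In it put $\iota_0=\langle1,0\rangle$, $\iota_1=\langle0,1\rangle$, $\nabla_A=\pi_0+\pi_1$, $\ell_A=\iota_0\times\iota_1:A\times A\to(A\times A)\times(A\times A)$, $c_A=\langle\pi_0\times\pi_0,\pi_1\times\pi_1\rangle$.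 A Cartesian differential category is a Cartesian left additive category with operators sending $f:A\to B$ to $\mathsf{D}[f]:A\times A\to B$ such that: [CD.1] $\mathsf{D}[f+g]=\mathsf{D}[f]+\mathsf{D}[g]$, $\mathsf{D}[0]=0$; [CD.2] $\mathsf{D}[f]\circ(1_A\times\nabla_A)=\mathsf{D}[f]\circ(1_A\times\pi_0)+\mathsf{D}[f]\circ(1_A\times\pi_1)$, $\mathsf{D}[f]\circ\iota_0=0$; [CD.3] $\mathsf{D}[1_A]=\pi_1$, $\mathsf{D}[\pi_j]=\pi_j\circ\pi_1$; [CD.4] $\mathsf{D}[\langle f,g\rangle]=\langle\mathsf{D}[f],\mathsf{D}[g]\rangle$; [CD.5] $\mathsf{D}[g\circ f]=\mathsf{D}[g]\circ\langle f\circ\pi_0,\mathsf{D}[f]\rangle$; [CD.6] $\mathsf{D}[\mathsf{D}[f]]\circ\ell_A=\mathsf{D}[f]$; [CD.7] $\mathsf{D}[\mathsf{D}[f]]\circ c_A=\mathsf{D}[\mathsf{D}[f]]$. A map $f$ is $\mathsf{D}$-linear if $\mathsf{D}[f]=f\circ\pi_1$; $\mathsf{D}\text{-}\mathsf{lin}[\mathbb{Y}]$ is the subcategory of $\mathbb{Y}$ with the same objects and the $\mathsf{D}$-linear maps. *)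

(* Defs.v *)
From HB Require Import structures.
From mathcomp Require Import all_boot all_order all_fingroup all_algebra.
From mathcomp Require Import boolp finmap monalg.

Set Implicit Arguments.
Unset Strict Implicit.
Unset Printing Implicit Defensive.

Import GRing.Theory.
Local Open Scope ring_scope.

Record category := Category {
  ob :> Type;
  hom : ob -> ob -> Type;
  idm : forall A, hom A A;
  compm : forall A B C, hom B C -> hom A B -> hom A C;
  compmA : forall A B C D (h : hom C D) (g : hom B C) (f : hom A B),
    compm h (compm g f) = compm (compm h g) f;
  comp1m : forall A B (f : hom A B), compm (idm B) f = f;
  compm1 : forall A B (f : hom A B), compm f (idm A) = f }.

Declare Scope cat_scope.
Delimit Scope cat_scope with cat.
Local Open Scope cat_scope.
Notation "g \oc f" := (compm g f) (at level 40, left associativity) : cat_scope.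

Definition cat_op (X : category) : category :=
  @Category X (fun A B => @hom X B A) (@idm X) (fun A B C g f => f \oc g)
    (fun A B C D h g f => esym (compmA f g h))
    (fun A B f => compm1 f) (fun A B f => comp1m f).

Record functor (X Y : category) := Functor {
  fob :> X -> Y;
  fmap : forall A B, hom A B -> hom (fob A) (fob B);
  fmap1 : forall A, fmap (idm A) = idm (fob A);
  fmapM : forall A B C (g : hom B C) (f : hom A B),
    fmap (g \oc f) = fmap g \oc fmap f }.

Definition functor_id (X : category) : functor X X :=
  @Functor X X (fun A => A) (fun A B f => f)
    (fun A => erefl) (fun A B C g f => erefl).

Section FunctorComp.
Variables (X Y Z : category) (G : functor Y Z) (H : functor X Y).
Fact functor_comp1 A : fmap G (fmap H (idm A)) = idm (G (H A)).
Proof. by rewrite !fmap1. Qed.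
Fact functor_compM A B C (g : hom B C) (f : hom A B) :
  fmap G (fmap H (g \oc f)) = fmap G (fmap H g) \oc fmap G (fmap H f).
Proof. by rewrite !fmapM. Qed.
Definition functor_comp : functor X Z :=
  @Functor X Z (fun A => G (H A)) (fun A B f => fmap G (fmap H f))
    functor_comp1 functor_compM.
End FunctorComp.

(* Functors are compared with Leibniz equality, so this is isomorphism of
   categories, not equivalence. *)
Definition cat_isomorphic (X Y : category) : Prop :=
  exists (G : functor X Y) (H : functor Y X),
    functor_comp H G = functor_id X /\ functor_comp G H = functor_id Y.

Record is_monad (X : category) (S : functor X X)
    (mu : forall V, hom (S (S V)) (S V)) (eta : forall V, hom V (S V)) : Prop :=
  IsMonad {
  mu_nat : forall V W (f : hom V W),
    mu W \oc fmap S (fmap S f) = fmap S f \oc mu V;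
  eta_nat : forall V W (f : hom V W), eta W \oc f = fmap S f \oc eta V;
  muA : forall V, mu V \oc fmap S (mu V) = mu V \oc mu (S V);
  mu_etal : forall V, mu V \oc eta (S V) = idm (S V);
  mu_etar : forall V, mu V \oc fmap S (eta V) = idm (S V) }.

Record monad (X : category) := Monad {
  mfun :> functor X X;
  mmult : forall V, hom (mfun (mfun V)) (mfun V);
  munit : forall V, hom V (mfun V);
  monadP : is_monad mmult munit }.

(* Categories with finite biproducts, presented through their enrichment in
   commutative monoids: [biproduct] is at once the product and the coproduct. *)
Record biprod_category := BiprodCategory {
  bcat :> category;
  badd : forall A B : bcat, hom A B -> hom A B -> hom A B;
  bzero : forall A B : bcat, hom A B;
  baddA : forall (A B : bcat), associative (@badd A B);
  baddC : forall (A B : bcat), commutative (@badd A B);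
  badd0 : forall (A B : bcat), left_id (bzero A B) (@badd A B);
  bcompDl : forall (A B C : bcat) (g h : hom B C) (f : hom A B),
    badd g h \oc f = badd (g \oc f) (h \oc f);
  bcompDr : forall (A B C : bcat) (f : hom B C) (g h : hom A B),
    f \oc badd g h = badd (f \oc g) (f \oc h);
  bcomp0l : forall (A B C : bcat) (f : hom A B), bzero B C \oc f = bzero A C;
  bcomp0r : forall (A B C : bcat) (f : hom B C), f \oc bzero A B = bzero A C;
  bnull : bcat;
  bnull_term : forall (A : bcat) (f : hom A bnull), f = bzero A bnull;
  bnull_init : forall (A : bcat) (f : hom bnull A), f = bzero bnull A;
  bprod : bcat -> bcat -> bcat;
  bpi0 : forall A B, hom (bprod A B) A;
  bpi1 : forall A B, hom (bprod A B) B;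
  biota0 : forall A B, hom A (bprod A B);
  biota1 : forall A B, hom B (bprod A B);
  bpi0_iota0 : forall A B, bpi0 A B \oc biota0 A B = idm A;
  bpi1_iota1 : forall A B, bpi1 A B \oc biota1 A B = idm B;
  bpi0_iota1 : forall A B, bpi0 A B \oc biota1 A B = bzero B A;
  bpi1_iota0 : forall A B, bpi1 A B \oc biota0 A B = bzero A B;
  biota_pi : forall A B,
    badd (biota0 A B \oc bpi0 A B) (biota1 A B \oc bpi1 A B) = idm (bprod A B)
}.

Section BiprodOps.
Variable X : biprod_category.
Implicit Types A B C D : X.

Definition bpair C A B (f : hom C A) (g : hom C B) : hom C (bprod A B) :=
  badd (biota0 A B \oc f) (biota1 A B \oc g).
Definition bcopair A B C (f : hom A C) (g : hom B C) : hom (bprod A B) C :=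
  badd (f \oc bpi0 A B) (g \oc bpi1 A B).
Definition bmap A B C D (f : hom A C) (g : hom B D) :
    hom (bprod A B) (bprod C D) :=
  bpair (f \oc bpi0 A B) (g \oc bpi1 A B).
Definition bdiag A : hom A (bprod A A) := bpair (idm A) (idm A).
(* The middle-four interchange <pi0 x pi0, pi1 x pi1>. *)
Definition bswap A : hom (bprod (bprod A A) (bprod A A))
                         (bprod (bprod A A) (bprod A A)) :=
  bpair (bmap (bpi0 A A) (bpi0 A A)) (bmap (bpi1 A A) (bpi1 A A)).
End BiprodOps.

Section DifferentialComonad.
Variables (X : biprod_category) (S : monad X).
Local Notation mu := (mmult S).
Local Notation eta := (munit S).
Local Notation "A \x B" := (@bprod X A B) (at level 40, left associativity).
Local Infix "+" := badd.
Local Notation "0" := (bzero _ _).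
Local Notation "1" := (idm _).
Local Notation pi0 := (bpi0 _ _).
Local Notation pi1 := (bpi1 _ _).
Local Notation iota0 := (biota0 _ _).
Local Notation iota1 := (biota1 _ _).

(* [d] makes [S], seen as a comonad on the opposite of [X], a Cartesian
   differential comonad. *)
Record is_differential_comonad (d : forall V : X, hom (S V) (S (V \x V))) :
    Prop := IsDifferentialComonad {
  dc_nat : forall (V W : X) (f : hom V W),
    d W \oc fmap S f = fmap S (bmap f f) \oc d V;
  dc1 : forall V : X, fmap S pi0 \oc d V = 0;
  dc2 : forall V : X,
    fmap S (bmap 1 (bdiag V)) \oc d V =
    (fmap S (bmap 1 iota0) + fmap S (bmap 1 iota1)) \oc d V;
  dc3 : forall V : X, d V \oc eta V = eta (V \x V) \oc iota1;
  dc4 : forall V : X,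
    d V \oc mu V =
    mu (V \x V) \oc fmap S (bcopair (fmap S iota0) (d V)) \oc d (S V);
  dc5 : forall V : X, fmap S (bmap pi0 pi1) \oc d (V \x V) \oc d V = d V;
  dc6 : forall V : X,
    fmap S (bswap V) \oc d (V \x V) \oc d V = d (V \x V) \oc d V }.

Record is_Dlinear_unit (d : forall V : X, hom (S V) (S (V \x V)))
    (eps : forall V : X, hom (S V) V) : Prop := IsDlinearUnit {
  du_nat : forall (V W : X) (f : hom V W), eps W \oc fmap S f = f \oc eps V;
  du1 : forall V : X, eps V \oc eta V = 1;
  du2 : forall V : X, eta V \oc eps V = fmap S pi1 \oc d V }.
End DifferentialComonad.

Record cartesian_left_additive := CartesianLeftAdditive {
  lcat :> category;
  ladd : forall A B : lcat, hom A B -> hom A B -> hom A B;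
  lzero : forall A B : lcat, hom A B;
  laddA : forall A B : lcat, associative (@ladd A B);
  laddC : forall A B : lcat, commutative (@ladd A B);
  ladd0 : forall A B : lcat, left_id (lzero A B) (@ladd A B);
  lcompDl : forall (A B C : lcat) (f g : hom B C) (x : hom A B),
    ladd f g \oc x = ladd (f \oc x) (g \oc x);
  lcomp0l : forall (A B C : lcat) (x : hom A B), lzero B C \oc x = lzero A C;
  lterm : lcat;
  lbang : forall A : lcat, hom A lterm;
  lbang_uniq : forall (A : lcat) (f : hom A lterm), f = lbang A;
  lprod : lcat -> lcat -> lcat;
  lpi0 : forall A B : lcat, hom (lprod A B) A;
  lpi1 : forall A B : lcat, hom (lprod A B) B;
  lpair : forall C A B : lcat, hom C A -> hom C B -> hom C (lprod A B);
  lpi0_pair : forall (C A B : lcat) (f : hom C A) (g : hom C B),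
    lpi0 A B \oc lpair f g = f;
  lpi1_pair : forall (C A B : lcat) (f : hom C A) (g : hom C B),
    lpi1 A B \oc lpair f g = g;
  lpair_uniq : forall (C A B : lcat) (h : hom C (lprod A B)),
    h = lpair (lpi0 A B \oc h) (lpi1 A B \oc h);
  lpi0D : forall (C A B : lcat) (x y : hom C (lprod A B)),
    lpi0 A B \oc ladd x y = ladd (lpi0 A B \oc x) (lpi0 A B \oc y);
  lpi00 : forall C A B : lcat, lpi0 A B \oc lzero C (lprod A B) = lzero C A;
  lpi1D : forall (C A B : lcat) (x y : hom C (lprod A B)),
    lpi1 A B \oc ladd x y = ladd (lpi1 A B \oc x) (lpi1 A B \oc y);
  lpi10 : forall C A B : lcat, lpi1 A B \oc lzero C (lprod A B) = lzero C B }.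

Section CartesianDifferential.
Variable X : cartesian_left_additive.
Local Notation "A \x B" := (@lprod X A B) (at level 40, left associativity).
Local Infix "+" := ladd.
Local Notation "0" := (lzero _ _).
Local Notation "1" := (idm _).
Local Notation pi0 := (lpi0 _ _).
Local Notation pi1 := (lpi1 _ _).
Implicit Types A B C : X.

Definition lmap A B C D (f : hom A C) (g : hom B D) : hom (A \x B) (C \x D) :=
  lpair (f \oc pi0) (g \oc pi1).
Definition liota0 A B : hom A (A \x B) := lpair 1 0.
Definition liota1 A B : hom B (A \x B) := lpair 0 1.
Definition lnabla A : hom (A \x A) A := pi0 + pi1.
Definition lell A : hom (A \x A) ((A \x A) \x (A \x A)) :=
  lmap (liota0 A A) (liota1 A A).
Definition lswap A :
    hom ((A \x A) \x (A \x A)) ((A \x A) \x (A \x A)) :=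
  lpair (lmap pi0 pi0) (lmap pi1 pi1).

Variable D : forall A B, hom A B -> hom (A \x A) B.

Record is_cartesian_differential : Prop := IsCartesianDifferential {
  CD1D : forall A B (f g : hom A B), D (f + g) = D f + D g;
  CD10 : forall A B, D (lzero A B) = 0;
  CD2D : forall A B (f : hom A B),
    D f \oc lmap 1 (lnabla A) = D f \oc lmap 1 pi0 + D f \oc lmap 1 pi1;
  CD20 : forall A B (f : hom A B), D f \oc liota0 A A = 0;
  CD3_id : forall A, D (idm A) = pi1;
  CD3_pi0 : forall A B, D (lpi0 A B) = pi0 \oc pi1;
  CD3_pi1 : forall A B, D (lpi1 A B) = pi1 \oc pi1;
  CD4 : forall A B C (f : hom C A) (g : hom C B),
    D (lpair f g) = lpair (D f) (D g);
  CD5 : forall A B C (g : hom B C) (f : hom A B),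
    D (g \oc f) = D g \oc lpair (f \oc pi0) (D f);
  CD6 : forall A B (f : hom A B), D (D f) \oc lell A = D f;
  CD7 : forall A B (f : hom A B), D (D f) \oc lswap A = D (D f) }.
End CartesianDifferential.

Record cartesian_differential := CartesianDifferential {
  cdc :> cartesian_left_additive;
  cdiff : forall A B : cdc, hom A B -> hom (lprod A A) B;
  cdcP : is_cartesian_differential cdiff }.

Section DLinear.
Variable X : cartesian_differential.
Implicit Types A B C : X.

Definition Dlinear A B (f : hom A B) : Prop := cdiff f = f \oc lpi1 A A.

Definition Dlin_hom A B : Type := {f : hom A B | Dlinear f}.

Lemma Dlin_ext A B (f g : Dlin_hom A B) : sval f = sval g -> f = g.
Proof.
case: f g => [f fl] [g gl] /= fg; case: _ / fg gl => gl.
by rewrite (Prop_irrelevance fl gl).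
Qed.

Fact Dlinear_id A : Dlinear (idm A).
Proof. by rewrite /Dlinear (CD3_id (cdcP X)) comp1m. Qed.

Fact Dlinear_comp A B C (g : hom B C) (f : hom A B) :
  Dlinear g -> Dlinear f -> Dlinear (g \oc f).
Proof.
rewrite /Dlinear (CD5 (cdcP X)) => -> ->.
by rewrite -compmA lpi1_pair compmA.
Qed.

Definition Dlin_id A : Dlin_hom A A := exist _ (idm A) (Dlinear_id A).
Definition Dlin_comp A B C (g : Dlin_hom B C) (f : Dlin_hom A B) :
    Dlin_hom A C :=
  exist _ (sval g \oc sval f) (Dlinear_comp (svalP g) (svalP f)).

Fact Dlin_compA A B C D (h : Dlin_hom C D) (g : Dlin_hom B C)
    (f : Dlin_hom A B) :
  Dlin_comp h (Dlin_comp g f) = Dlin_comp (Dlin_comp h g) f.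
Proof. by apply: Dlin_ext; exact: compmA. Qed.
Fact Dlin_comp1m A B (f : Dlin_hom A B) : Dlin_comp (Dlin_id B) f = f.
Proof. by apply: Dlin_ext; exact: comp1m. Qed.
Fact Dlin_compm1 A B (f : Dlin_hom A B) : Dlin_comp f (Dlin_id A) = f.
Proof. by apply: Dlin_ext; exact: compm1. Qed.

Definition Dlin : category :=
  @Category X Dlin_hom Dlin_id (@Dlin_comp) (@Dlin_compA)
    (@Dlin_comp1m) (@Dlin_compm1).
End DLinear.

(* The opposite of the Kleisli category of [S]. *)
Section OpKleisli.
Variables (X : biprod_category) (S : monad X).
Local Notation mu := (mmult S).
Local Notation eta := (munit S).
Implicit Types A B C D : X.

(* A map A -> B is a map B -> S A of X. *)
Definition kl_hom A B : Type := hom B (S A).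
Definition kl_comp A B C (g : kl_hom B C) (f : kl_hom A B) : kl_hom A C :=
  mu A \oc fmap S f \oc g.

Fact kl_compA A B C D (h : kl_hom C D) (g : kl_hom B C) (f : kl_hom A B) :
  kl_comp h (kl_comp g f) = kl_comp (kl_comp h g) f.
Proof.
rewrite /kl_comp !fmapM !compmA (muA (monadP S)).
by rewrite -(compmA (mu A) (mu (S A))) (mu_nat (monadP S)) !compmA.
Qed.

Fact kl_comp1 A B (f : kl_hom A B) : kl_comp f (eta A) = f.
Proof. by rewrite /kl_comp (mu_etar (monadP S)) comp1m. Qed.

Lemma kl_comp_eta A B C (k : hom C B) (f : kl_hom A B) :
  kl_comp (eta B \oc k) f = f \oc k.
Proof.
rewrite /kl_comp !compmA -(compmA (mu A)) -(eta_nat (monadP S)) compmA.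
by rewrite (mu_etal (monadP S)) comp1m.
Qed.

Fact kl_1comp A B (f : kl_hom A B) : kl_comp (eta B) f = f.
Proof. by rewrite -[RHS]compm1 -kl_comp_eta compm1. Qed.

Definition op_kleisli_cat : category :=
  @Category X kl_hom eta kl_comp kl_compA kl_1comp kl_comp1.

Definition kl_pi0 A B : kl_hom (bprod A B) A :=
  eta (bprod A B) \oc biota0 A B.
Definition kl_pi1 A B : kl_hom (bprod A B) B :=
  eta (bprod A B) \oc biota1 A B.

Fact kl_compDl A B C (f g : kl_hom B C) (x : kl_hom A B) :
  kl_comp (badd f g) x = badd (kl_comp f x) (kl_comp g x).
Proof. exact: bcompDr. Qed.

Fact kl_comp0l A B C (x : kl_hom A B) :
  kl_comp (bzero _ _ : kl_hom B C) x = bzero _ _.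
Proof. exact: bcomp0r. Qed.

Fact kl_pi0_pair C A B (f : kl_hom C A) (g : kl_hom C B) :
  kl_comp (kl_pi0 A B) (bcopair f g) = f.
Proof.
rewrite kl_comp_eta /bcopair bcompDl -!compmA bpi0_iota0 bpi1_iota0.
by rewrite compm1 bcomp0r baddC badd0.
Qed.

Fact kl_pi1_pair C A B (f : kl_hom C A) (g : kl_hom C B) :
  kl_comp (kl_pi1 A B) (bcopair f g) = g.
Proof.
rewrite kl_comp_eta /bcopair bcompDl -!compmA bpi0_iota1 bpi1_iota1.
by rewrite compm1 bcomp0r badd0.
Qed.

Fact kl_pair_uniq C A B (h : kl_hom C (bprod A B)) :
  h = bcopair (kl_comp (kl_pi0 A B) h) (kl_comp (kl_pi1 A B) h).
Proof.
by rewrite !kl_comp_eta /bcopair -!compmA -bcompDr biota_pi compm1.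
Qed.

Fact kl_pi0D C A B (x y : kl_hom C (bprod A B)) :
  kl_comp (kl_pi0 A B) (badd x y) =
  badd (kl_comp (kl_pi0 A B) x) (kl_comp (kl_pi0 A B) y).
Proof. by rewrite !kl_comp_eta bcompDl. Qed.

Fact kl_pi00 C A B :
  kl_comp (kl_pi0 A B) (bzero _ _ : kl_hom C (bprod A B)) = bzero _ _.
Proof. by rewrite kl_comp_eta bcomp0l. Qed.

Fact kl_pi1D C A B (x y : kl_hom C (bprod A B)) :
  kl_comp (kl_pi1 A B) (badd x y) =
  badd (kl_comp (kl_pi1 A B) x) (kl_comp (kl_pi1 A B) y).
Proof. by rewrite !kl_comp_eta bcompDl. Qed.

Fact kl_pi10 C A B :
  kl_comp (kl_pi1 A B) (bzero _ _ : kl_hom C (bprod A B)) = bzero _ _.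
Proof. by rewrite kl_comp_eta bcomp0l. Qed.

Definition op_kleisli : cartesian_left_additive :=
  @CartesianLeftAdditive op_kleisli_cat
    (fun A B => @badd X B (S A)) (fun A B => @bzero X B (S A))
    (fun A B => @baddA X B (S A)) (fun A B => @baddC X B (S A))
    (fun A B => @badd0 X B (S A)) kl_compDl kl_comp0l
    (bnull X) (fun A => bzero (bnull X) (S A))
    (fun A => @bnull_init X (S A))
    (@bprod X) kl_pi0 kl_pi1 (fun C A B f g => bcopair f g)
    kl_pi0_pair kl_pi1_pair kl_pair_uniq kl_pi0D kl_pi00 kl_pi1D kl_pi10.

Definition op_kleisli_diff (d : forall V : X, hom (S V) (S (bprod V V)))
    (A B : op_kleisli) (f : hom A B) : hom (lprod A A) B :=
  @compm X _ _ _ (d A) f.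
End OpKleisli.
Close Scope cat_scope.

Definition mklin (F : fieldType) (U W : lmodType F) (f : U -> W)
    (fl : linear f) : {linear U -> W} :=
  HB.pack f (GRing.isLinear.Build F U W *:%R f fl).

Arguments mklin : simpl never.

Lemma lin_ext (F : fieldType) (U W : lmodType F) (f g : {linear U -> W}) :
  f =1 g -> f = g.
Proof.
case: f g => [f cf] [g cg] /= /funext fg; case: _ / fg cg => cg.
congr (GRing.Linear.Pack _).
case: cf cg => [[s1] [a1]] [[s2] [a2]].
by rewrite (Prop_irrelevance s1 s2) (Prop_irrelevance a1 a2).
Qed.

Section Vec.
Variable F : fieldType.

Definition vec_comp (U V W : lmodType F) (g : {linear V -> W})
  (f : {linear U -> V}) : {linear U -> W} := g \o f.

Fact vec_compA (A B C D : lmodType F) (h : {linear C -> D})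
    (g : {linear B -> C}) (f : {linear A -> B}) :
  vec_comp h (vec_comp g f) = vec_comp (vec_comp h g) f.
Proof. exact: lin_ext. Qed.
Fact vec_comp1m (A B : lmodType F) (f : {linear A -> B}) : vec_comp idfun f = f.
Proof. exact: lin_ext. Qed.
Fact vec_compm1 (A B : lmodType F) (f : {linear A -> B}) : vec_comp f idfun = f.
Proof. exact: lin_ext. Qed.

Definition vec_cat : category :=
  @Category (lmodType F) (fun V W => {linear V -> W}) (fun V => idfun)
    vec_comp vec_compA vec_comp1m vec_compm1.

Definition vec_add (V W : lmodType F) (f g : {linear V -> W}) :
  {linear V -> W} := f \+ g.
Definition vec_zero (V W : lmodType F) : {linear V -> W} := \0.

Fact vec_addA V W : associative (@vec_add V W).
Proof. by move=> f g h; apply: lin_ext => x; exact: addrA. Qed.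
Fact vec_addC V W : commutative (@vec_add V W).
Proof. by move=> f g; apply: lin_ext => x; exact: addrC. Qed.
Fact vec_add0 V W : left_id (vec_zero V W) (@vec_add V W).
Proof. by move=> f; apply: lin_ext => x; exact: add0r. Qed.
Fact vec_compDl (A B C : lmodType F) (g h : {linear B -> C}) (f : {linear A -> B}) :
  vec_comp (vec_add g h) f = vec_add (vec_comp g f) (vec_comp h f).
Proof. exact: lin_ext. Qed.
Fact vec_compDr (A B C : lmodType F) (f : {linear B -> C}) (g h : {linear A -> B}) :
  vec_comp f (vec_add g h) = vec_add (vec_comp f g) (vec_comp f h).
Proof. by apply: lin_ext => x; exact: linearD. Qed.
Fact vec_comp0l (A B C : lmodType F) (f : {linear A -> B}) :
  vec_comp (vec_zero B C) f = vec_zero A C.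
Proof. exact: lin_ext. Qed.
Fact vec_comp0r (A B C : lmodType F) (f : {linear B -> C}) :
  vec_comp f (vec_zero A B) = vec_zero A C.
Proof. by apply: lin_ext => x; exact: linear0. Qed.
Fact vec_null_term (A : lmodType F) (f : {linear A -> 'rV[F]_0}) :
  f = vec_zero _ _.
Proof. by apply: lin_ext => x; exact: thinmx0. Qed.
Fact vec_null_init (A : lmodType F) (f : {linear 'rV[F]_0 -> A}) :
  f = vec_zero _ _.
Proof. by apply: lin_ext => x; rewrite (thinmx0 x) linear0. Qed.

Section Biproduct.
Variables V W : lmodType F.
Definition vec_pi0 : {linear (V * W)%type -> V} := fst.
Definition vec_pi1 : {linear (V * W)%type -> W} := snd.
Fact inj0_linear : linear (fun v : V => (v, 0 : W)).
Proof. by move=> a u v; congr pair; rewrite /= scaler0 addr0. Qed.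
Fact inj1_linear : linear (fun w : W => (0 : V, w)).
Proof. by move=> a u v; congr pair; rewrite /= scaler0 addr0. Qed.
Definition vec_iota0 : {linear V -> (V * W)%type} := mklin inj0_linear.
Definition vec_iota1 : {linear W -> (V * W)%type} := mklin inj1_linear.
Fact vec_pi0_iota0 : vec_comp vec_pi0 vec_iota0 = idfun.
Proof. exact: lin_ext. Qed.
Fact vec_pi1_iota1 : vec_comp vec_pi1 vec_iota1 = idfun.
Proof. exact: lin_ext. Qed.
Fact vec_pi0_iota1 : vec_comp vec_pi0 vec_iota1 = vec_zero _ _.
Proof. exact: lin_ext. Qed.
Fact vec_pi1_iota0 : vec_comp vec_pi1 vec_iota0 = vec_zero _ _.
Proof. exact: lin_ext. Qed.
Fact vec_iota_pi :
  vec_add (vec_comp vec_iota0 vec_pi0) (vec_comp vec_iota1 vec_pi1) = idfun.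
Proof.
apply: lin_ext => -[x y].
by rewrite -[LHS]/(x + 0, 0 + y) addr0 add0r.
Qed.
End Biproduct.

Definition vec : biprod_category :=
  @BiprodCategory vec_cat vec_add vec_zero vec_addA vec_addC vec_add0
    vec_compDl vec_compDr vec_comp0l vec_comp0r
    ('rV[F]_0 : lmodType F) vec_null_term vec_null_init
    (fun V W : lmodType F => (V * W)%type : lmodType F)
    vec_pi0 vec_pi1 vec_iota0 vec_iota1 vec_pi0_iota0 vec_pi1_iota1
    vec_pi0_iota1 vec_pi1_iota0 vec_iota_pi.
End Vec.

Section TensorPower.
Variables (F : fieldType) (V : lmodType F) (n : nat).
Implicit Types (x : {ffun 'I_n -> V}) (i : 'I_n) (a : F) (u v : V).

Definition ffset x i v : {ffun 'I_n -> V} :=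
  [ffun j => if j == i then v else x j].

Definition multilinear (W : lmodType F) (f : {ffun 'I_n -> V} -> W) : Prop :=
  forall x i a u v,
    f (ffset x i (a *: u + v)) = a *: f (ffset x i u) + f (ffset x i v).

Definition tfree : lmodType F := {malg F[{ffun 'I_n -> V}]}.
Definition tgen x : tfree := << x >>.

Inductive tensor_rel : tfree -> Prop :=
| TensorRel0 : tensor_rel 0
| TensorRelP a (y z : tfree) :
    tensor_rel y -> tensor_rel z -> tensor_rel (a *: y + z)
| TensorRelM x i a u v :
    tensor_rel (tgen (ffset x i (a *: u + v))
                - (a *: tgen (ffset x i u) + tgen (ffset x i v))).

(* [tpow V n] is the n-th tensor power of V: the free F-module on n-tuples of
   vectors, modulo the submodule [tensor_rel] generated by multilinearity. *)
Definition tensor_relb : {pred tfree} := fun z => `[< tensor_rel z >].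

Lemma tensor_relb_closed : zmod_closed tensor_relb.
Proof.
split=> [|y z]; first by apply/asboolP; exact: TensorRel0.
move=> /asboolP Ry /asboolP Rz; apply/asboolP.
by rewrite addrC -scaleN1r; apply: TensorRelP.
Qed.

HB.instance Definition _ :=
  GRing.isZmodClosed.Build tfree tensor_relb tensor_relb_closed.

Definition tpow : Type :=
  Quotient.quot (GRing.ZmodClosed.clone tfree tensor_relb _).
HB.instance Definition _ := GRing.Zmodule.on tpow.

Definition tpi : tfree -> tpow := \pi_(tpow)%qT.

Lemma tpiB : {morph tpi : y z / y - z}.
Proof. by move=> y z; rewrite /tpi raddfB. Qed.

Lemma tpiE y z : (tpi y = tpi z) <-> tensor_rel (y - z).
Proof.
split=> [/eqP|h]; first by rewrite /tpi -Quotient.idealrBE => /asboolP.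
by apply/eqP; rewrite /tpi -Quotient.idealrBE; apply/asboolP.
Qed.

Definition tscale a (t : tpow) : tpow := tpi (a *: generic_quotient.repr t).

Lemma tscaleE a y : tscale a (tpi y) = tpi (a *: y).
Proof.
apply/tpiE; rewrite -scalerBr -[_ *: _]addr0; apply: TensorRelP.
  by apply/tpiE; rewrite /tpi generic_quotient.reprK.
exact: TensorRel0.
Qed.

Lemma tpi_surj t : exists y, t = tpi y.
Proof. by exists (generic_quotient.repr t); rewrite /tpi generic_quotient.reprK. Qed.

Lemma tpiD : {morph tpi : y z / y + z}.
Proof. by move=> y z; rewrite /tpi raddfD. Qed.

Lemma tscaleA a b t : tscale a (tscale b t) = tscale (a * b) t.
Proof. by case: (tpi_surj t) => y ->; rewrite !tscaleE scalerA. Qed.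
Lemma tscale1 : left_id 1 tscale.
Proof. by move=> t; case: (tpi_surj t) => y ->; rewrite tscaleE scale1r. Qed.
Lemma tscaleDr : right_distributive tscale +%R.
Proof.
move=> a s t; case: (tpi_surj t) (tpi_surj s) => y -> [z ->].
by rewrite -tpiD !tscaleE scalerDr tpiD.
Qed.
Lemma tscaleDl t : {morph tscale^~ t : a b / a + b}.
Proof.
by move=> a b; case: (tpi_surj t) => y ->; rewrite !tscaleE scalerDl tpiD.
Qed.
HB.instance Definition _ :=
  GRing.Zmodule_isLmodule.Build F tpow tscaleA tscale1 tscaleDr tscaleDl.

Lemma tpi_linear : linear tpi.
Proof. by move=> a y z; rewrite tpiD -tscaleE. Qed.

Definition tens x : tpow := tpi (tgen x).

Lemma tens_multilinear : multilinear tens.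
Proof. by move=> x i a u v; rewrite /tens -tpi_linear; apply/tpiE/TensorRelM. Qed.

Section FreeLift.
Variables (W : lmodType F) (f : {ffun 'I_n -> V} -> W).

Definition tfree_lift (y : tfree) : W :=
  \sum_(k <- msupp y) (y : {malg F[_]})@_k *: f k.

Lemma tfree_liftw (d : {fset {ffun 'I_n -> V}}) (y : tfree) :
  (msupp y `<=` d)%fset -> tfree_lift y = \sum_(k <- d) (y : {malg F[_]})@_k *: f k.
Proof.
move=> le; rewrite /tfree_lift; apply/big_fset_incl => // k _ /mcoeff_outdom ->.
by rewrite scale0r.
Qed.

Lemma tfree_lift_linear : linear tfree_lift.
Proof.
move=> a y z; pose d := (msupp y `|` msupp z)%fset.
have ly : (msupp y `<=` d)%fset by exact: fsubsetUl.
have lz : (msupp z `<=` d)%fset by exact: fsubsetUr.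
have lyz : (msupp (a *: y + z : tfree) `<=` d)%fset.
  apply: fsubset_trans (msuppD_le _ _) _; apply: fsetSU.
  exact: msuppZ_le.
rewrite !(tfree_liftw ly, tfree_liftw lz, tfree_liftw lyz).
rewrite scaler_sumr -big_split /=; apply: eq_bigr => k _.
by rewrite mcoeffD mcoeffZ scalerDl scalerA.
Qed.

Lemma tfree_liftE x : tfree_lift (tgen x) = f x.
Proof.
by rewrite /tfree_lift msuppU oner_eq0 big_seq_fset1 mcoeffUU scale1r.
Qed.
End FreeLift.

Lemma tfree_eta (y : tfree) : y = tfree_lift tgen y.
Proof.
rewrite {1}[y]monalgE; apply: eq_bigr => k _.
apply/malgP => l; rewrite mcoeffZ !mcoeffU.
by case: eqP; rewrite ?mulr1 ?mulr0.
Qed.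

Lemma tens_span (t : tpow) : exists s : seq (F * {ffun 'I_n -> V}),
  t = \sum_(p <- s) p.1 *: tens p.2.
Proof.
case: (tpi_surj t) => y ->.
exists [seq ((y : {malg F[_]})@_k, k) | k <- msupp y].
rewrite big_map {1}[y]tfree_eta /tfree_lift.
have tpi0 : tpi 0 = 0 by rewrite -(subrr 0) tpiB subrr.
elim/big_rec2: _ => // k t' y' _ <-.
by rewrite tpi_linear.
Qed.

Section Lift.
Variables (W : lmodType F) (f : {ffun 'I_n -> V} -> W).
Hypothesis fM : multilinear f.

Definition tlift (t : tpow) : W := tfree_lift f (generic_quotient.repr t).

Lemma tfree_lift_rel y : tensor_rel y -> tfree_lift f y = 0.
Proof.
have fl := tfree_lift_linear f.
have f0 : tfree_lift f 0 = 0.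
  by have := fl (-1) 0 0; rewrite scaler0 addr0 scaleN1r addNr.
have fB y' z' : tfree_lift f (y' - z') = tfree_lift f y' - tfree_lift f z'.
  by rewrite addrC -scaleN1r fl scaleN1r addrC.
elim=> [//|a y' z' _ IHy _ IHz|x i a u v]; first by rewrite fl IHy IHz scaler0 addr0.
by rewrite fB fl !tfree_liftE fM subrr.
Qed.

Lemma tlift_tpi y : tlift (tpi y) = tfree_lift f y.
Proof.
rewrite /tlift -[RHS]addr0.
have fl := tfree_lift_linear f.
have <- : tfree_lift f (generic_quotient.repr (tpi y) - y) = 0.
  apply: tfree_lift_rel; apply/tpiE.
  by rewrite /tpi generic_quotient.reprK.
by rewrite -[y in LHS]scale1r -[X in X + _]scale1r -fl addrCA scale1r subrr addr0.
Qed.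

Lemma tlift_linear : linear tlift.
Proof.
move=> a s t; case: (tpi_surj s) (tpi_surj t) => y -> [z ->].
by rewrite -tpi_linear !tlift_tpi tfree_lift_linear.
Qed.

Lemma tliftE x : tlift (tens x) = f x.
Proof. by rewrite tlift_tpi tfree_liftE. Qed.
End Lift.

End TensorPower.
Section TensorMaps.
Variables (F : fieldType) (n : nat).

(* Permutations of 'S_n compose from left to right, [(s * t) i = t (s i)], so
   x |-> x \o s is a left action of 'S_n on tuples (see [tactM]); it is the
   usual place permutation by the inverse of s. *)
Lemma tact_multilinear (V : lmodType F) (s : 'S_n) :
  multilinear (fun x : {ffun 'I_n -> V} => tens [ffun i => x (s i)]).
Proof.
move=> x i a u v /=.
have E w : [ffun j => ffset x i w (s j)] =
           ffset [ffun j => x (s j)] ((s^-1)%g i) w.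
  apply/ffunP => j; rewrite !ffunE.
  by rewrite -(can_eq (permK s) j) permKV; case: eqP => // _; rewrite ffunE.
by rewrite !E tens_multilinear.
Qed.

Definition tact (V : lmodType F) (s : 'S_n) : tpow V n -> tpow V n :=
  tlift (fun x : {ffun 'I_n -> V} => tens [ffun i => x (s i)]).
Arguments tact : simpl never.
HB.instance Definition _ V s := GRing.isLinear.Build F (tpow V n) (tpow V n)
  *:%R (@tact V s) (tlift_linear (tact_multilinear s)).

Lemma tmap_multilinear (V W : lmodType F) (f : {linear V -> W}) :
  multilinear (fun x : {ffun 'I_n -> V} => tens [ffun i => f (x i)]).
Proof.
move=> x i a u v /=.
have E w : [ffun j => f (ffset x i w j)] = ffset [ffun j => f (x j)] i (f w).
  by apply/ffunP => j; rewrite !ffunE; case: eqP.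
by rewrite !E linearP tens_multilinear.
Qed.

Definition tmap (V W : lmodType F) (f : {linear V -> W}) :
    tpow V n -> tpow W n :=
  tlift (fun x : {ffun 'I_n -> V} => tens [ffun i => f (x i)]).
Arguments tmap : simpl never.
HB.instance Definition _ V W f := GRing.isLinear.Build F (tpow V n) (tpow W n)
  *:%R (@tmap V W f) (tlift_linear (tmap_multilinear f)).

Lemma tactE (V : lmodType F) s x : @tact V s (tens x) = tens [ffun i => x (s i)].
Proof. exact: (tliftE (tact_multilinear s)). Qed.

Lemma tmapE (V W : lmodType F) (f : {linear V -> W}) x : @tmap V W f (tens x) = tens [ffun i => f (x i)].
Proof. exact: (tliftE (tmap_multilinear f)). Qed.

Lemma tens_ext (V W : lmodType F) (f g : {linear tpow V n -> W}) :
  (forall x, f (tens x) = g (tens x)) -> f =1 g.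
Proof.
move=> fg t; case: (tens_span t) => s ->; rewrite !linear_sum /=.
by apply: eq_bigr => p _; rewrite !linearZ /= fg.
Qed.

Lemma tactM (V : lmodType F) s t x : @tact V s (tact t x) = tact (s * t)%g x.
Proof.
apply: (tens_ext (f := tact s \o tact t)) => {}x /=.
by rewrite !tactE; congr tens; apply/ffunP => i; rewrite !ffunE permM.
Qed.

Lemma tact_tmap (V W : lmodType F) (f : {linear V -> W}) s x :
  tact s (tmap f x) = tmap f (tact s x).
Proof.
apply: (tens_ext (f := tact s \o tmap f) (g := tmap f \o tact s)) => {}x /=.
by rewrite !(tactE, tmapE); congr tens; apply/ffunP => i; rewrite !ffunE.
Qed.

Lemma tmap_id (V : lmodType F) : @tmap V V idfun =1 id.
Proof.
apply: (tens_ext (g := idfun)) => x /=.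
by rewrite tmapE; congr tens; apply/ffunP => i; rewrite !ffunE.
Qed.

Lemma tmap_comp (U V W : lmodType F) (f : {linear V -> W}) (g : {linear U -> V}) :
  tmap (f \o g) =1 tmap f \o tmap g.
Proof.
apply: (tens_ext (g := tmap f \o tmap g)) => x /=.
by rewrite !tmapE; congr tens; apply/ffunP => i; rewrite !ffunE.
Qed.

End TensorMaps.

Section Gamma.
Variables (F : fieldType).

(* Index n stands for tensor degree n + 1, as Gamma(V) starts in degree 1. *)
Definition tfam (V : lmodType F) : Type := forall n, tpow V n.+1.

Section FamLmod.
Variable V : lmodType F.
HB.instance Definition _ := gen_eqMixin (tfam V).
HB.instance Definition _ := gen_choiceMixin (tfam V).
Let add (x y : tfam V) : tfam V := fun n => x n + y n.
Let opp (x : tfam V) : tfam V := fun n => - x n.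
Let zero : tfam V := fun n => 0.
Let scale (a : F) (x : tfam V) : tfam V := fun n => a *: x n.
Fact tfam_addA : associative add.
Proof. by move=> x y z; apply: functional_extensionality_dep => n; exact: addrA. Qed.
Fact tfam_addC : commutative add.
Proof. by move=> x y; apply: functional_extensionality_dep => n; exact: addrC. Qed.
Fact tfam_add0 : left_id zero add.
Proof. by move=> x; apply: functional_extensionality_dep => n; exact: add0r. Qed.
Fact tfam_addN : left_inverse zero opp add.
Proof. by move=> x; apply: functional_extensionality_dep => n; exact: addNr. Qed.
HB.instance Definition _ :=
  GRing.isZmodule.Build (tfam V) tfam_addA tfam_addC tfam_add0 tfam_addN.
Fact tfam_scaleA a b x : scale a (scale b x) = scale (a * b) x.
Proof. by apply: functional_extensionality_dep => n; exact: scalerA. Qed.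
Fact tfam_scale1 : left_id 1 scale.
Proof. by move=> x; apply: functional_extensionality_dep => n; exact: scale1r. Qed.
Fact tfam_scaleDr : right_distributive scale +%R.
Proof. by move=> a x y; apply: functional_extensionality_dep => n; exact: scalerDr. Qed.
Fact tfam_scaleDl x : {morph scale^~ x : a b / a + b}.
Proof. by move=> a b; apply: functional_extensionality_dep => n; exact: scalerDl. Qed.
HB.instance Definition _ := GRing.Zmodule_isLmodule.Build F (tfam V)
  tfam_scaleA tfam_scale1 tfam_scaleDr tfam_scaleDl.
End FamLmod.

Section GammaSpace.
Variable V : lmodType F.

(* Finitely supported families of symmetric tensors: the direct sum over
   n >= 1 of the invariants of 'S_n in the n-th tensor power. *)
Definition in_gamma : {pred tfam V} := fun x =>
  `[< (forall n (s : 'S_n.+1), tact s (x n) = x n)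
      /\ exists N, forall n, (N <= n)%N -> x n = 0 >].

Fact in_gamma_closed : submod_closed in_gamma.
Proof.
split=> [|a x y /asboolP[xs [N xN]] /asboolP[ys [M yM]]]; apply/asboolP; split.
- by move=> n s; exact: linear0.
- by exists 0%N.
- by move=> n s; rewrite -[LHS]/(tact s (a *: x n + y n)) linearP /= xs ys.
- exists (maxn N M) => n; rewrite geq_max => /andP[/xN xn /yM yn].
  by rewrite -[LHS]/(a *: x n + y n) xn yn scaler0 addr0.
Qed.

HB.instance Definition _ :=
  GRing.isSubmodClosed.Build F (tfam V) in_gamma in_gamma_closed.

Record gamma_space : Type := Gamma {
  gamma_fam : tfam V;
  gamma_famP : gamma_fam \in in_gamma }.
HB.instance Definition _ := [isSub for gamma_fam].
HB.instance Definition _ := [Choice of gamma_space by <:].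
HB.instance Definition _ := [SubChoice_isSubLmodule of gamma_space by <:].

Definition gamma : lmodType F := gamma_space.
End GammaSpace.
End Gamma.

Section GammaMap.
Variables (F : fieldType).
Implicit Types (V W : lmodType F).

Fact gmap_in V W (f : {linear V -> W}) (x : gamma V) :
  (fun n => tmap f (gamma_fam x n) : tpow W n.+1) \in @in_gamma F W.
Proof.
case: x => x /= /asboolP[xs [N xN]]; apply/asboolP; split.
  by move=> n s; rewrite tact_tmap xs.
by exists N => n /xN ->; exact: linear0.
Qed.

Definition gmap V W (f : {linear V -> W}) (x : gamma V) : gamma W :=
  Gamma (gmap_in f x).
Arguments gmap : simpl never.

Lemma gamma_ext V (x y : gamma V) :
  (forall n, gamma_fam x n = gamma_fam y n) -> x = y.
Proof. by move=> xy; apply/val_inj/functional_extensionality_dep. Qed.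

Fact gmap_linear V W (f : {linear V -> W}) : linear (gmap f).
Proof.
by move=> a x y; apply: gamma_ext => n; exact: (linearP (tmap f)).
Qed.
HB.instance Definition _ V W f :=
  GRing.isLinear.Build F (gamma V) (gamma W) *:%R (@gmap V W f) (gmap_linear f).

(* A divided power monomial v_1^[r_1] * ... * v_n^[r_n] is written as the list
   [:: (v_1, r_1); ...; (v_n, r_n)]; its value in Gamma(V) is [dpm]. *)
Definition dp_exps V (m : seq (V * nat)) : seq nat := [seq p.2 | p <- m].

(* S(r_1) x ... x S(r_n) inside S(r_1 + ... + r_n): the permutations preserving
   each of the consecutive blocks of sizes r_1, ..., r_n. [reshape_index r k] is
   the index of the block that contains position k. *)
Definition young (r : seq nat) n : {set 'S_n} :=
  [set s : 'S_n |
    [forall k : 'I_n, reshape_index r (s k) == reshape_index r k]].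

(* v_1 (r_1 times), ..., v_n (r_n times). *)
Definition dp_word V (m : seq (V * nat)) n : {ffun 'I_n -> V} :=
  [ffun k : 'I_n => nth 0 [seq p.1 | p <- m] (reshape_index (dp_exps m) k)].

(* The choice of coset representatives is immaterial by [lcoset_word]. *)
Definition dp_tensor V (m : seq (V * nat)) n : tpow V n :=
  \sum_(C in lcosets (young (dp_exps m) n) [set: 'S_n])
     tact (fingroup.repr C) (tens (dp_word m n)).

Definition dp_comp V (m : seq (V * nat)) n : tpow V n :=
  if n == sumn (dp_exps m) then dp_tensor m n else 0.

Lemma young_group_set r n : group_set (young r n).
Proof.
apply/group_setP; split=> [|s t].
  by rewrite inE; apply/forallP => k; rewrite perm1.
rewrite !inE => /forallP hs /forallP ht; apply/forallP => k.
by rewrite permM (eqP (ht _)) hs.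
Qed.
Canonical young_group r n := group (young_group_set r n).

Lemma young_word V (m : seq (V * nat)) n s : s \in young (dp_exps m) n ->
  tact s (tens (dp_word m n)) = tens (dp_word m n).
Proof.
rewrite inE => /forallP hs; rewrite tactE; congr tens; apply/ffunP => k.
by rewrite !ffunE (eqP (hs k)).
Qed.

Lemma lcoset_word V (m : seq (V * nat)) n s t : t \in (s *: young (dp_exps m) n)%g ->
  tact t (tens (dp_word m n)) = tact s (tens (dp_word m n)).
Proof. by case/lcosetP => u hu ->; rewrite -tactM young_word. Qed.

Lemma dp_tensor_inv V (m : seq (V * nat)) n s :
  tact s (dp_tensor m n) = dp_tensor m n.
Proof.
rewrite /dp_tensor linear_sum /=.
set Y := young _ _; set w := dp_word _ _.
have mulK : cancel (fun C : {set 'S_n} => s *: C)%g (fun C : {set 'S_n} => s^-1 *: C)%g.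
  by move=> C; rewrite -lcosetM mulVg lcoset1.
rewrite [RHS](reindex_onto (fun C : {set 'S_n} => s *: C)%g (fun C : {set 'S_n} => s^-1 *: C)%g); last first.
  by move=> C _; rewrite -lcosetM mulgV lcoset1.
apply: eq_big => [C|C /lcosetsP[t _ ->]].
  rewrite mulK eqxx andbT; apply/lcosetsP/lcosetsP => -[t _].
    by move=> ->; exists (s * t)%g; rewrite ?inE // lcosetM.
  by move=> /(congr1 (fun C => s^-1 *: C)%g); rewrite mulK -lcosetM => ->; exists (s^-1 * t)%g; rewrite ?inE.
have rep u : fingroup.repr (u *: Y)%g \in (u *: Y)%g.
  by apply: (mem_repr u); exact: lcoset_refl.
rewrite -lcosetM tactM (lcoset_word (rep (s * t)%g)).
by apply: lcoset_word; rewrite lcosetM mem_lcoset mulKg; exact: rep.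
Qed.

Fact dpm_in V (m : seq (V * nat)) :
  (fun n => dp_comp m n.+1) \in @in_gamma F V.
Proof.
apply/asboolP; split=> [n s|].
  by rewrite /dp_comp; case: eqP => _; [exact: dp_tensor_inv|exact: linear0].
exists (sumn (dp_exps m)) => n le; rewrite /dp_comp ifN //.
by rewrite neq_ltn ltnS le orbT.
Qed.

Definition dpm V (m : seq (V * nat)) : gamma V := Gamma (dpm_in m).

Lemma gmap_dpm V W (f : {linear V -> W}) (m : seq (V * nat)) :
  gmap f (dpm m) = dpm [seq (f p.1, p.2) | p <- m].
Proof.
apply: gamma_ext => n; rewrite -[LHS]/(tmap f (dp_comp m n.+1)).
rewrite -[RHS]/(dp_comp _ n.+1) /dp_comp.
have -> : dp_exps [seq (f p.1, p.2) | p <- m] = dp_exps m.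
  by rewrite /dp_exps -map_comp; apply: eq_map.
case: eqP => _; last exact: linear0.
rewrite /dp_tensor linear_sum /=.
have -> : dp_exps [seq (f p.1, p.2) | p <- m] = dp_exps m.
  by rewrite /dp_exps -map_comp; apply: eq_map.
apply: eq_bigr => C _; rewrite -tact_tmap tmapE; congr (tact _ (tens _)).
apply/ffunP => k; rewrite !ffunE.
have -> : dp_exps [seq (f p.1, p.2) | p <- m] = dp_exps m.
  by rewrite /dp_exps -map_comp; apply: eq_map.
set j := reshape_index _ _.
case: (ltnP j (size m)) => hj.
  by rewrite -map_comp !(nth_map (0, 0%N)) ?size_map.
by rewrite !nth_default ?size_map // linear0.
Qed.

End GammaMap.

Section DividedPowerMonad.
Variable F : fieldType.
Implicit Types V W : lmodType F.

Definition gamma_map V W (f : {linear V -> W}) : {linear gamma V -> gamma W} :=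
  gmap f.

Fact gamma_map1 V : gamma_map (idfun : {linear V -> V}) = idfun.
Proof. by apply: lin_ext => x; apply: gamma_ext => n; exact: tmap_id. Qed.
Fact gamma_mapM (U V W : lmodType F) (g : {linear V -> W}) (f : {linear U -> V}) :
  gamma_map (vec_comp g f) = vec_comp (gamma_map g) (gamma_map f).
Proof. by apply: lin_ext => x; apply: gamma_ext => n; exact: tmap_comp. Qed.

Definition gamma_functor : functor (vec F) (vec F) :=
  @Functor (vec F) (vec F) (@gamma F) gamma_map gamma_map1 gamma_mapM.

Fact gamma_eta_linear V : linear (fun v : V => dpm [:: (v, 1%N)]).
Proof.
have E v : dp_word [:: (v, 1%N)] 1 = ffset [ffun=> 0] ord0 v.
  by apply/ffunP => k; rewrite !ffunE ord1.
move=> a u v; apply: gamma_ext => n.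
rewrite -[RHS]/(a *: dp_comp _ n.+1 + dp_comp _ n.+1).
rewrite -[LHS]/(dp_comp _ n.+1) /dp_comp /=.
case: eqP => [[->]|_]; last by rewrite scaler0 addr0.
rewrite /dp_tensor scaler_sumr -big_split /=; apply: eq_bigr => C _.
by rewrite !E tens_multilinear linearP.
Qed.

Definition gamma_eta V : {linear V -> gamma V} := mklin (@gamma_eta_linear V).

(* At least one factor, and strictly positive exponents. *)
Definition dp_wf (T : Type) (m : seq (T * nat)) : bool :=
  (0 < size m)%N && all (fun p => (0 < p.2)%N) m.

(* The product over i of 1/r_i! \prod_j (r_i q_ij)! / (q_ij!)^r_i; the
   Euclidean divisions are exact by [mu_coefE]. *)
Definition mu_coef (T : Type) (mm : seq (seq (T * nat) * nat)) : nat :=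
  (\prod_(p <- mm)
     ((\prod_(x <- p.1) (p.2 * x.2)`!)
      %/ (p.2`! * \prod_(x <- p.1) x.2`! ^ p.2)))%N.

Lemma dvdn_block_fact q r : (0 < q)%N -> (r`! * q`! ^ r %| (r * q)`!)%N.
Proof.
move=> q0; elim: r => // r IHr.
have le : (q <= r.+1 * q)%N by rewrite leq_pmull.
rewrite -(bin_fact le) {2}mulSn addKn expnS factS.
have -> : 'C(r.+1 * q, q) = (r.+1 * 'C((r.+1 * q).-1, q.-1))%N.
  have := mul_bin_diag (r.+1 * q) q.-1; rewrite prednK // => h.
  by apply/eqP; rewrite -(eqn_pmul2l q0) -h mulnCA mulnA.
rewrite -!mulnA dvdn_pmul2l // dvdn_mull //.
by rewrite mulnCA dvdn_pmul2l ?fact_gt0.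
Qed.

Lemma mu_coefE (T : Type) (mm : seq (seq (T * nat) * nat)) :
  dp_wf mm -> all (fun p => dp_wf p.1) mm ->
  (mu_coef mm * \prod_(p <- mm) (p.2`! * \prod_(x <- p.1) x.2`! ^ p.2)
   = \prod_(p <- mm) \prod_(x <- p.1) (p.2 * x.2)`!)%N.
Proof.
move=> _; rewrite /mu_coef; elim: mm => [|[m r] mm IH] /=; first by rewrite !big_nil.
case/andP=> /andP[]; case: m => [//|[x q] m] _ /= /andP[q0 mw] /IH {}IH.
rewrite !big_cons /= -IH mulnACA; congr (_ * _)%N; rewrite divnK //.
rewrite mulnA dvdn_mul ?dvdn_block_fact //.
elim: m mw => [|[y l] m IHm] /=; first by rewrite !big_nil.
case/andP=> l0 /IHm {}IHm; rewrite !big_cons dvdn_mul //=.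
by apply: dvdn_trans (dvdn_block_fact r l0); exact: dvdn_mull.
Qed.

Definition mu_monomial (T : Type) (mm : seq (seq (T * nat) * nat)) :
    seq (T * nat) :=
  flatten [seq [seq (x.1, (p.2 * x.2)%N) | x <- p.1] | p <- mm].

Definition is_gamma_mu (mu : forall V, {linear gamma (gamma V) -> gamma V}) :
    Prop :=
  forall V (mm : seq (seq (V * nat) * nat)),
    dp_wf mm -> all (fun p => dp_wf p.1) mm ->
    mu V (dpm [seq (dpm p.1, p.2) | p <- mm]) =
    (mu_coef mm)%:R *: dpm (mu_monomial mm).

(* The i-th summand (counting from 0) of the differential of a monomial. *)
Definition diff_monomial V (m : seq (V * nat)) (i : nat) :
    seq ((V * V) * nat) :=
  let inl (p : V * nat) := ((p.1, 0 : V), p.2) in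
  let: (v, r) := nth (0, 0%N) m i in
  map inl (take i m)
  ++ (if r == 1%N then [::] else [:: ((v, 0), r.-1)])
  ++ map inl (drop i.+1 m)
  ++ [:: ((0, v), 1%N)].

Definition is_gamma_diff
    (d : forall V, {linear gamma V -> gamma (V * V)%type}) : Prop :=
  forall V (m : seq (V * nat)), dp_wf m ->
    d V (dpm m) = \sum_(i < size m) dpm (diff_monomial m i).

Definition is_gamma_eps (eps : forall V, {linear gamma V -> V}) : Prop :=
  forall V (m : seq (V * nat)), dp_wf m ->
    eps V (dpm m) = if m is [:: (v, 1%N)] then v else 0.
End DividedPowerMonad.

(* Main.v *)
From HB Require Import structures.
From mathcomp Require Import all_boot all_order all_fingroup all_algebra.
From mathcomp Require Import boolp classical_sets ring zify.
Require Import Defs.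

(* Words in linear functionals turn Gamma(V) into functions. For a set A of
   letters, the functions [seq A -> F] form a commutative ring under the shuffle
   product, and (f, g) |-> f < g, the shuffles that begin with a letter of f, is
   an integral of f' g. Hence z^[r] := z < (z < ... (z < 1)) is a system of
   divided powers in every characteristic. A linear map f from V to this ring
   extends to Gamma(V): send v_1 (x) ... (x) v_n to f v_1 < (f v_2 < ... f v_n).
   Symmetric tensors being sums over words, a divided power monomial goes to the
   product of the (f v_i)^[r_i].

   With A = V^* and f the evaluation of vectors, this gives an embedding E of
   Gamma(V). The maps mu, d and eps are then determined by E o mu = (the
   extension of E to Gamma(Gamma(V))), by E o d = D o E where D replaces one
   letter of a word by its second component and the others by their first
   components, and by phi(eps x) = E x [phi]. They exist because these formulas
   agree with the prescribed ones on divided power monomials, which span; the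
   coefficients in mu come from the expression of the divided powers of a
   product of divided powers. All axioms become identities between functions of
   words, where D is a derivation and E x is additive in every letter. *)

Set Implicit Arguments.
Unset Strict Implicit.
Unset Printing Implicit Defensive.

Import GRing.Theory.
Local Open Scope ring_scope.

(** * The shuffle ring and its divided powers *)

Definition shuffle (F : comNzRingType) (A : Type) : Type := seq A -> F.

Section ShuffleRing.
Variables (F : comNzRingType) (A : Type).
Local Notation Z := (shuffle F A).
Implicit Types (f g h : Z) (a : A) (l : seq A) (c : F).

HB.instance Definition _ := gen_eqMixin Z.
HB.instance Definition _ := gen_choiceMixin Z.

Definition shuffle_deriv a f : Z := fun l => f (a :: l).
Local Notation "''d_' a" := (shuffle_deriv a) (at level 8, a at level 2).

Definition shuffle_zero : Z := fun=> 0.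
Definition shuffle_one : Z := fun l => (nilp l)%:R.
Definition shuffle_add f g : Z := fun l => f l + g l.
Definition shuffle_opp f : Z := fun l => - f l.
Definition shuffle_scale c f : Z := fun l => c * f l.
(** The shuffle product, by recursion on the word: its first letter goes either to [f] or to [g].
    Removal of the first letter is thus a derivation by definition. *)
Fixpoint shuffle_eval l f g : F :=
  if l is a :: l' then shuffle_eval l' ('d_a f) g + shuffle_eval l' f ('d_a g)
  else f [::] * g [::].
Definition shuffle_mul f g : Z := fun l => shuffle_eval l f g.

Fact shuffle_addA : associative shuffle_add.
Proof. by move=> f g h; apply: funext => l; exact: addrA. Qed.
Fact shuffle_addC : commutative shuffle_add.
Proof. by move=> f g; apply: funext => l; exact: addrC. Qed.
Fact shuffle_add0 : left_id shuffle_zero shuffle_add.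
Proof. by move=> f; apply: funext => l; exact: add0r. Qed.
Fact shuffle_addN : left_inverse shuffle_zero shuffle_opp shuffle_add.
Proof. by move=> f; apply: funext => l; exact: addNr. Qed.
HB.instance Definition _ := GRing.isZmodule.Build Z
  shuffle_addA shuffle_addC shuffle_add0 shuffle_addN.

Fact shuffle_mulC : commutative shuffle_mul.
Proof.
move=> f g; apply: funext => l; rewrite /shuffle_mul.
by elim: l f g => [|a l IH] f g /=; [exact: mulrC|rewrite addrC !(IH f) (IH _ g)].
Qed.
Fact shuffle_mulDl : left_distributive shuffle_mul +%R.
Proof.
move=> f g h; apply: funext => l; rewrite /shuffle_mul -[RHS]/(_ + _).
elim: l f g h => [|a l IH] f g h /=; first exact: mulrDl.
rewrite -[shuffle_deriv a (f + g)]/('d_a f + 'd_a g) !IH; ring.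
Qed.
Fact shuffle_mulA : associative shuffle_mul.
Proof.
move=> f g h; apply: funext => l; rewrite /shuffle_mul.
elim: l f g h => [|a l IH] f g h /=; first exact: mulrA.
have mulDl (u v w : Z) : shuffle_eval l (u + v) w = shuffle_eval l u w + shuffle_eval l v w.
  exact: (congr1 (fun z : Z => z l) (shuffle_mulDl u v w)).
have mulDr (u v w : Z) : shuffle_eval l u (v + w) = shuffle_eval l u v + shuffle_eval l u w.
  by rewrite -![shuffle_eval l u _]/(shuffle_mul u _ l) !(shuffle_mulC u) /shuffle_mul mulDl.
rewrite -[shuffle_deriv a (fun l => shuffle_eval l f g)]/(shuffle_mul ('d_a f) g + shuffle_mul f ('d_a g)).
rewrite -[shuffle_deriv a (fun l => shuffle_eval l g h)]/(shuffle_mul ('d_a g) h + shuffle_mul g ('d_a h)).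
by rewrite mulDl mulDr !IH addrA.
Qed.
Fact shuffle_mul1 : left_id shuffle_one shuffle_mul.
Proof.
move=> f; apply: funext => l; rewrite /shuffle_mul.
elim: l f => [|a l IH] f /=; first exact: mul1r.
rewrite IH -[RHS]add0r; congr (_ + _).
rewrite -[LHS]/(shuffle_mul ('d_a shuffle_one) f l).
have -> : 'd_a shuffle_one = shuffle_zero by [].
(* The ring structure is not yet available, so 0 f = 0 is read off from (0 + 0) f = 0 f + 0 f. *)
have := shuffle_mulDl shuffle_zero shuffle_zero f; rewrite addr0.
by move/(congr1 (fun g : Z => g l))/eqP; rewrite -subr_eq0 opprD addNKr oppr_eq0 => /eqP.
Qed.
Fact shuffle_one_neq0 : shuffle_one != 0 :> Z.
Proof.
by apply/eqP => /(congr1 (fun g : Z => g [::]))/eqP; rewrite oner_eq0.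
Qed.
HB.instance Definition _ := GRing.Zmodule_isComNzRing.Build Z
  shuffle_mulA shuffle_mulC shuffle_mul1 shuffle_mulDl shuffle_one_neq0.

Fact shuffle_scaleA c c' f : shuffle_scale c (shuffle_scale c' f) = shuffle_scale (c * c') f.
Proof. by apply: funext => l; exact: mulrA. Qed.
Fact shuffle_scale1 : left_id 1 shuffle_scale.
Proof. by move=> f; apply: funext => l; exact: mul1r. Qed.
Fact shuffle_scaleDr : right_distributive shuffle_scale +%R.
Proof. by move=> c f g; apply: funext => l; exact: mulrDr. Qed.
Fact shuffle_scaleDl f : {morph shuffle_scale^~ f : c c' / c + c'}.
Proof. by move=> c c'; apply: funext => l; exact: mulrDl. Qed.
HB.instance Definition _ := GRing.Zmodule_isLmodule.Build F Z
  shuffle_scaleA shuffle_scale1 shuffle_scaleDr shuffle_scaleDl.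
Fact shuffle_scaleAl c f g : c *: (f * g) = (c *: f) * g.
Proof.
apply: funext => l; rewrite -[LHS]/(c * shuffle_eval l f g).
rewrite -[RHS]/(shuffle_eval l (c *: f) g).
elim: l f g => [|a l IH] f g /=; first exact: mulrA.
by rewrite mulrDr !IH.
Qed.
HB.instance Definition _ := GRing.Lmodule_isLalgebra.Build F Z shuffle_scaleAl.

Lemma shuffle_addE f g l : (f + g) l = f l + g l. Proof. by []. Qed.
Lemma shuffle_0E l : (0 : Z) l = 0. Proof. by []. Qed.
Lemma shuffle_scaleE c f l : (c *: f) l = c * f l. Proof. by []. Qed.
Lemma shuffle_1E l : (1 : Z) l = (nilp l)%:R. Proof. by []. Qed.
Lemma shuffle_mul_nil f g : (f * g) [::] = f [::] * g [::]. Proof. by []. Qed.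
Lemma shuffle_sumE I (r : seq I) (P : pred I) (G : I -> Z) l :
  (\sum_(i <- r | P i) G i) l = \sum_(i <- r | P i) G i l.
Proof. by elim/big_rec2: _ => // i x y _ <-. Qed.
Lemma shuffle_prod_nil I (r : seq I) (P : pred I) (G : I -> Z) :
  (\prod_(i <- r | P i) G i) [::] = \prod_(i <- r | P i) G i [::].
Proof. by elim/big_rec2: _ => // i x y _ <-. Qed.

(** A function of words consists of its constant term and its derivatives, so identities are proved
    as in calculus: compare at the empty word, then differentiate. *)
Lemma shuffle_ext f g : f [::] = g [::] -> (forall a, 'd_a f = 'd_a g) -> f = g.
Proof.
move=> fg0 fg; apply: funext => -[//|a l].
by rewrite -[LHS]/('d_a f l) fg.
Qed.

Fact shuffle_deriv_linear a : linear 'd_a.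
Proof. by []. Qed.
HB.instance Definition _ a :=
  GRing.isLinear.Build F Z Z *:%R 'd_a (shuffle_deriv_linear a).

Lemma shuffle_derivM a f g : 'd_a (f * g) = 'd_a f * g + f * 'd_a g.
Proof. by []. Qed.
Lemma shuffle_deriv1 a : 'd_a 1 = 0.
Proof. by []. Qed.
Lemma shuffle_derivX a f n : 'd_a (f ^+ n.+1) = 'd_a f * f ^+ n *+ n.+1.
Proof.
elim: n => [|n IH]; first by rewrite expr1 expr0 mulr1.
by rewrite exprS shuffle_derivM IH mulrnAr mulrCA -exprS -mulrS.
Qed.

Lemma shuffle_deriv_prod (I : finType) (G : I -> Z) a :
  'd_a (\prod_i G i) = \sum_i 'd_a (G i) * \prod_(j | j != i) G j.
Proof.
suff H (s : seq I) : uniq s -> 'd_a (\prod_(i <- s) G i) =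
    \sum_(i <- s) 'd_a (G i) * \prod_(j <- s | j != i) G j.
  by rewrite H // index_enum_uniq.
elim: s => [|i s IH] /=; first by rewrite !big_nil.
case/andP=> is_ us; rewrite !big_cons shuffle_derivM (IH us) eqxx /=.
congr (_ * _ + _).
  by rewrite [RHS]big_seq_cond [LHS]big_seq; apply: eq_bigl => j;
    case: (boolP (j \in s)) => //= js; apply/esym; apply: contraNneq is_ => <-.
rewrite mulr_sumr [LHS]big_seq [RHS]big_seq; apply: eq_bigr => j js.
have ij : i != j by apply: contraNneq is_ => ->.
by rewrite big_cons ij mulrCA.
Qed.

(* The Zinbiel product: the shuffles in which the first letter of the word comes
   from [f]. It is the integral of [f' g]. *)
Definition half_shuffle f g : Z :=
  fun l => if l is a :: l' then ('d_a f * g) l' else 0.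

Lemma half_shuffle_nil f g : half_shuffle f g [::] = 0.
Proof. by []. Qed.
Lemma half_shuffle_deriv a f g : 'd_a (half_shuffle f g) = 'd_a f * g.
Proof. by []. Qed.
Lemma half_shuffle_linearl g : linear (half_shuffle^~ g).
Proof.
move=> c f f'; apply: shuffle_ext => [|a].
  by rewrite shuffle_addE shuffle_scaleE !half_shuffle_nil mulr0 addr0.
by rewrite linearP /= !half_shuffle_deriv linearP /= mulrDl scalerAl.
Qed.
Lemma half_shuffle_linearr f : linear (half_shuffle f).
Proof.
move=> c g g'; apply: shuffle_ext => [|a].
  by rewrite shuffle_addE shuffle_scaleE !half_shuffle_nil mulr0 addr0.
rewrite linearP /= !half_shuffle_deriv mulrDr; congr (_ + _).
by rewrite mulrC -scalerAl mulrC.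
Qed.
HB.instance Definition _ f :=
  GRing.isLinear.Build F Z Z *:%R (half_shuffle f) (half_shuffle_linearr f).

(** Only the derivatives of [f] enter [half_shuffle f], so this is the divided power of [f] minus
    its constant term. Hence the vanishing constant terms assumed in [dpow1], [dpowS] and
    [dpow_mul]. *)
Fixpoint dpow f n : Z := if n is n'.+1 then half_shuffle f (dpow f n') else 1.

#[local] Arguments dpow : simpl never.

Lemma dpow0 f : dpow f 0 = 1. Proof. by []. Qed.
Lemma dpow_nil f n : dpow f n [::] = (n == 0)%:R.
Proof. by case: n. Qed.
Lemma deriv_dpow a f n : 'd_a (dpow f n.+1) = 'd_a f * dpow f n.
Proof. by []. Qed.
Lemma dpow1 f : f [::] = 0 -> dpow f 1 = f.
Proof.
move=> f0; apply: shuffle_ext => [|a]; first by rewrite f0.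
by rewrite deriv_dpow mulr1.
Qed.

(** Differentiation lowers one of the two exponents, which yields Pascal's rule; hence the induction
    on m + n. *)
Lemma dpowM f m n : dpow f m * dpow f n = dpow f (m + n) *+ 'C(m + n, m).
Proof.
have [k] := ubnP (m + n); elim: k m n => // k IH [|m] [|n] lt.
- by rewrite mul1r.
- by rewrite mul1r bin0.
- by rewrite addn0 binn mulr1.
apply: shuffle_ext => [|a].
  rewrite shuffle_mul_nil addSn mul0r.
  by elim: 'C(_, _) => // p IHp; rewrite mulrSr shuffle_addE -IHp addr0.
rewrite shuffle_derivM linearMn /= addSn !deriv_dpow.
rewrite -mulrA IH // mulrCA.
rewrite IH; last by rewrite addSnnS -ltnS -addSn.
by rewrite [(m.+1 + n)%N]addSnnS binS mulrnDr !mulrnAr addrC.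
Qed.
End ShuffleRing.
Arguments dpow {F A} f n : simpl never.

(** * Divided powers of products and of divided powers *)

Section DividedPowers.
Variables (F : comNzRingType) (A : Type).
Implicit Types f g : shuffle F A.

Lemma dpowS f n : f [::] = 0 -> f * dpow f n = dpow f n.+1 *+ n.+1.
Proof. by move=> f0; rewrite -{1}(dpow1 f0) dpowM add1n bin1. Qed.

(** The derivative of the left side contains f' g f^n g^[n], and g g^[n] = (n + 1) g^[n+1] supplies
    the factor n + 1 from the derivative of f^(n+1). *)
Lemma dpow_mul f g n : g [::] = 0 -> dpow (f * g) n = f ^+ n * dpow g n.
Proof.
move=> g0; elim: n => [|n IH]; first by rewrite expr0 mul1r.
apply: shuffle_ext => [|a]; first by rewrite shuffle_mul_nil !dpow_nil mulr0.
rewrite deriv_dpow !shuffle_derivM deriv_dpow shuffle_derivX IH mulrDl.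
congr (_ + _); last by rewrite exprS; ring.
by rewrite mulrACA (dpowS _ g0) mulrnAr -mulrnAl.
Qed.

Lemma dpowX f q n : exists2 K : nat,
  (K * q`! ^ n = (n * q)`!)%N & dpow f q ^+ n = dpow f (n * q) *+ K.
Proof.
elim: n => [|n [K EK IH]]; first by exists 1%N; rewrite ?mul0n.
exists ('C(n.+1 * q, q) * K)%N; last first.
  by rewrite exprS IH mulrnAr dpowM -mulrnA mulSn.
have le : (q <= n.+1 * q)%N by rewrite leq_pmull.
rewrite -(bin_fact le) {3}mulSn addKn -EK expnS; lia.
Qed.

(** [K] counts the partitions of n q points into n blocks of size q. *)
Lemma dpow_dpow f q n : (0 < q)%N -> exists2 K : nat,
  (K * (n`! * q`! ^ n) = (n * q)`!)%N & dpow (dpow f q) n = dpow f (n * q) *+ K.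
Proof.
move=> q0; elim: n => [|n [K EK IH]]; first by exists 1%N; rewrite ?mul0n.
(* Differentiation leaves f' f^[q-1] f^[nq], whose last two factors multiply with this binomial
   coefficient: the block of a chosen point is completed by q - 1 of the other points. *)
exists ('C((n.+1 * q).-1, q.-1) * K)%N.
  have le : (q <= n.+1 * q)%N by rewrite leq_pmull.
  rewrite -(bin_fact le) {3}mulSn addKn -EK expnS factS.
  have -> : 'C(n.+1 * q, q) = (n.+1 * 'C((n.+1 * q).-1, q.-1))%N.
    have := mul_bin_diag (n.+1 * q) q.-1; rewrite prednK // => h.
    by apply/eqP; rewrite -(eqn_pmul2l q0) -h mulnCA mulnA.
  by lia.
case: q q0 EK IH => // q _ EK IH.
apply: shuffle_ext => [|a].
  rewrite dpow_nil mulSn addSn.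
  by elim: ('C(_, _) * K)%N => // k IHk; rewrite mulrSr shuffle_addE -IHk addr0.
rewrite mulSn addSn deriv_dpow deriv_dpow IH linearMn /= deriv_dpow.
by rewrite mulrnAr -mulrA dpowM mulrnAr -mulrnA.
Qed.

Section Monomials.
Variables (T : Type) (z : T -> shuffle F A).

(** By [dpow_mul] all factors but the last contribute ordinary r-th powers and only the last one a
    divided power, so r! is divided out once. Positive exponents ensure that the remaining product
    has no constant term. *)
Lemma dpow_prod (m : seq (T * nat)) r : dp_wf m -> exists2 K : nat,
  (K * (r`! * \prod_(p <- m) p.2`! ^ r) = \prod_(p <- m) (r * p.2)`!)%N &
  dpow (\prod_(p <- m) dpow (z p.1) p.2) r =
    (\prod_(p <- m) dpow (z p.1) (r * p.2)) *+ K.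
Proof.
case: m => // x m /andP[_].
elim: m x => [|y m IH] x /= /andP[q0 wf].
  rewrite !big_seq1; have [K EK EZ] := dpow_dpow (z x.1) r q0.
  by exists K.
have {IH} [K EK EZ] := IH y wf.
have [L EL ELZ] := dpowX (z x.1) x.2 r.
exists (L * K)%N; rewrite !(big_cons _ _ x) /=.
  by rewrite -EL -EK; lia.
rewrite dpow_mul ?ELZ ?EZ; first by rewrite mulrnAl mulrnAr -mulrnA [(K * _)%N]mulnC.
case/andP: wf => q1 _.
by rewrite big_cons shuffle_mul_nil dpow_nil gtn_eqF ?mul0r.
Qed.

(** The product equation of [dpow_prod] shows that each quotient in [mu_coef] is the factor by which
    the corresponding divided power of a product expands. *)
Lemma dpow_mu_monomial (mm : seq (seq (T * nat) * nat)) :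
  all (fun p => dp_wf p.1) mm ->
  \prod_(p <- mm) dpow (\prod_(x <- p.1) dpow (z x.1) x.2) p.2 =
  (\prod_(x <- mu_monomial mm) dpow (z x.1) x.2) *+ mu_coef mm.
Proof.
rewrite /mu_coef /mu_monomial; elim: mm => [|[m r] mm IH] /=.
  by rewrite !big_nil.
case/andP=> wf /IH {}IH; rewrite !big_cons big_cat IH big_map /=.
have [K EK ->] := dpow_prod r wf.
rewrite -EK mulnK; first by rewrite mulrnAl mulrnAr -mulrnA [(K * _)%N]mulnC.
by rewrite muln_gt0 fact_gt0 prodn_gt0 // => p; rewrite expn_gt0 fact_gt0.
Qed.
End Monomials.
End DividedPowers.

(** * Change of letters and the differential on functions of words *)

Section ShuffleMaps.
Variables (F : comNzRingType).

Definition shuffle_map A B (al : B -> A) (f : shuffle F A) : shuffle F B :=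
  fun l => f (map al l).

Section Map.
Variables (A B : Type) (al : B -> A).
Local Notation h := (shuffle_map al).

Fact shuffle_map_linear : linear h. Proof. by []. Qed.
HB.instance Definition _ := GRing.isLinear.Build F (shuffle F A) (shuffle F B)
  *:%R h shuffle_map_linear.
Fact shuffle_map_monoid : monoid_morphism h.
Proof.
split=> [|f g]; apply: funext => l; first by rewrite -[LHS]/((nilp _)%:R); case: l.
rewrite -[LHS]/(shuffle_eval (map al l) f g) -[RHS]/(shuffle_eval l (h f) (h g)).
by elim: l f g => //= b l IH f g; rewrite !IH.
Qed.
HB.instance Definition _ := GRing.isMonoidMorphism.Build (shuffle F A) (shuffle F B)
  h shuffle_map_monoid.

Lemma shuffle_deriv_map b f :
  shuffle_deriv b (h f) = h (shuffle_deriv (al b) f).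
Proof. by []. Qed.

Lemma shuffle_map_dpow f n : h (dpow f n) = dpow (h f) n.
Proof.
elim: n => [|n IH]; first exact: rmorph1.
apply: shuffle_ext => [|b]; first by [].
by rewrite deriv_dpow shuffle_deriv_map deriv_dpow rmorphM /= IH.
Qed.
End Map.

Lemma shuffle_map_comp A B C (al : B -> A) (be : C -> B) f :
  shuffle_map be (shuffle_map al f) = shuffle_map (al \o be) f.
Proof. by apply: funext => l; rewrite /shuffle_map map_comp. Qed.

(* The sum over the positions of the word of the values of [f] on the word in
   which [be] is applied at that position, and [al] at all the others. *)
Fixpoint shuffle_diff_eval A B (al be : B -> A) (f : shuffle F A) (l : seq B) : F :=
  if l is b :: l' then
    f (be b :: map al l') + shuffle_diff_eval al be (shuffle_deriv (al b) f) l'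
  else 0.
Definition shuffle_diff A B (al be : B -> A) f : shuffle F B :=
  shuffle_diff_eval al be f.

Section Diff.
Variables (A B : Type) (al be : B -> A).
Local Notation h := (shuffle_map al).
Local Notation D := (shuffle_diff al be).
Local Notation "''d_' a" := (shuffle_deriv a) (at level 8, a at level 2).

Fact shuffle_diff_linear : linear D.
Proof.
move=> c f g; apply: funext => l.
rewrite shuffle_addE shuffle_scaleE /shuffle_diff.
elim: l f g => [|b l IH] f g /=; first by rewrite mulr0 addr0.
by rewrite linearP IH shuffle_addE shuffle_scaleE mulrDr; ring.
Qed.
HB.instance Definition _ := GRing.isLinear.Build F (shuffle F A) (shuffle F B)
  *:%R D shuffle_diff_linear.

Lemma shuffle_diff_nil f : D f [::] = 0. Proof. by []. Qed.
Lemma shuffle_deriv_diff b f : 'd_b (D f) = h ('d_(be b) f) + D ('d_(al b) f).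
Proof. by []. Qed.

Lemma shuffle_diffM f g : D (f * g) = D f * h g + h f * D g.
Proof.
apply: funext => l; elim: l f g => [|b l IH] f g.
  by rewrite shuffle_addE !shuffle_mul_nil shuffle_diff_nil mul0r mulr0 addr0.
rewrite -[LHS]/('d_b (D (f * g)) l) -[RHS]/('d_b (D f * h g + h f * D g) l).
rewrite [X in _ = X l]linearD /= !shuffle_derivM !shuffle_deriv_diff !shuffle_deriv_map.
rewrite !shuffle_derivM !linearD /= !rmorphM /=.
rewrite ![in LHS]shuffle_addE !IH -!shuffle_addE.
apply: (congr1 (fun z : shuffle F B => z l)); ring.
Qed.

Lemma shuffle_diff1 : D 1 = 0.
Proof.
have := shuffle_diffM 1 1; rewrite mulr1 rmorph1 mulr1 mul1r => /eqP.
by rewrite -subr_eq0 opprD addNKr oppr_eq0 => /eqP.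
Qed.

Lemma shuffle_diff_dpow f n : D (dpow f n.+1) = dpow (h f) n * D f.
Proof.
elim: n => [|n IH]; apply: shuffle_ext => [|b];
  rewrite ?shuffle_mul_nil ?shuffle_diff_nil ?mulr0 //.
  by rewrite !shuffle_deriv_diff !deriv_dpow !mulr1 mul1r.
rewrite shuffle_derivM !shuffle_deriv_diff !deriv_dpow !rmorphM /=.
rewrite shuffle_diffM IH shuffle_deriv_map shuffle_map_dpow; ring.
Qed.

(** Leibniz's rule by position, in the shape of the sum that prescribes the differential of a
    monomial: the factors before and after the k-th one only undergo the change of letters. *)
Lemma shuffle_diff_prod (I : Type) (s : seq I) (G : I -> shuffle F A) (i0 : I) :
  D (\prod_(i <- s) G i) =
  \sum_(k < size s) h (\prod_(i <- take k s) G i) * D (G (nth i0 s k))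
     * h (\prod_(i <- drop k.+1 s) G i).
Proof.
elim: s => [|i s IH]; first by rewrite big_nil big_ord0 shuffle_diff1.
rewrite big_ord_recl big_cons shuffle_diffM /= big_nil rmorph1 mul1r drop0 IH.
congr (_ + _); rewrite mulr_sumr; apply: eq_bigr => k _.
by rewrite big_cons rmorphM /= !mulrA.
Qed.
End Diff.
End ShuffleMaps.

(** * Divided power monomials as sums over words *)

Definition word_content k (r : 'I_k -> nat) (w : seq 'I_k) : bool :=
  [forall j : 'I_k, count_mem j w == r j].

Section Words.

Lemma count_reshape_index (r : seq nat) j :
  count (fun i => reshape_index r i == j) (iota 0 (sumn r)) = nth 0%N r j.
Proof.
elim: r j => [|q r IH] j /=; first by rewrite nth_nil.
rewrite iotaD count_cat add0n.
have -> : count (fun i => reshape_index (q :: r) i == j) (iota 0 q) =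
    ((0%N == j) * q)%N.
  have /eq_in_count -> : {in iota 0 q, (fun i => reshape_index (q :: r) i == j) =1
      fun=> 0%N == j}.
    move=> i; rewrite mem_iota /= add0n => lt.
    by rewrite /reshape_index /= subn_eq0 lt.
  by case: eqP => _; rewrite ?count_predT ?size_iota ?mul1n // count_pred0.
rewrite -[in iota q _](addn0 q) iotaDl count_map.
have -> : count (preim (addn q) (fun i => reshape_index (q :: r) i == j))
    (iota 0 (sumn r)) = count (fun i => (reshape_index r i).+1 == j) (iota 0 (sumn r)).
  apply: eq_count => i /=; rewrite /reshape_index /= subn_eq0 ltnNge leq_addr /=.
  by rewrite -addnS addKn.
case: j => [|j] /=; first by rewrite mul1n count_pred0 addn0.
by rewrite add0n IH.
Qed.

Variables (F : fieldType) (V : lmodType F) (m : seq (V * nat)) (n : nat).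
Hypothesis En : n = sumn (dp_exps m).

Fact word_index_proof (i : 'I_n) : (reshape_index (dp_exps m) i < size m)%N.
Proof.
by rewrite -(size_map snd m); apply: reshape_indexP; rewrite -En.
Qed.
Let w0 (i : 'I_n) : 'I_(size m) := Ordinal (word_index_proof i).
Let word (s : 'S_n) : n.-tuple 'I_(size m) := [tuple w0 (s i) | i < n].

Let r (j : 'I_(size m)) : nat := nth 0%N (dp_exps m) j.

Let content_w0 : word_content r [tuple w0 i | i < n].
Proof.
apply/forallP => j; rewrite /r -count_reshape_index -En -val_enum_ord count_map /=.
by rewrite count_map; apply/eqP/eq_count => i /=; rewrite -val_eqE.
Qed.

Let wordP (w : n.-tuple 'I_(size m)) :
  reflect (exists s, w = word s) (word_content r w).
Proof.
have -> : word_content r w = perm_eq w [tuple w0 i | i < n].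
  apply/forallP/idP => [h|/seq.permP h j]; last first.
    by rewrite h; exact: (forallP content_w0 j).
  apply/allP => j _ /=; rewrite (eqP (h j)) eq_sym.
  exact: (forallP content_w0 j).
apply: (iffP tuple_permP) => -[s Ew]; exists s.
  by apply: val_inj; rewrite /= Ew /=; apply: eq_map => i; rewrite tnth_mktuple.
by rewrite Ew /=; apply: eq_map => i; rewrite tnth_mktuple.
Qed.

(** The Young subgroup is the stabiliser of the sorted word [w0], so its left cosets are the fibres
    of [word]. *)
Let young_wordP s t :
  reflect (word s = word t) (t \in (s *: young (dp_exps m) n)%g).
Proof.
rewrite mem_lcoset inE; apply: (iffP forallP) => [h|h k].
  apply: eq_from_tnth => i; rewrite !tnth_mktuple; apply: val_inj => /=.
  by have := h (s i); rewrite permM permK => /eqP.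
have := congr1 (fun w : n.-tuple _ => val (tnth w ((s^-1)%g k))) h.
by rewrite !tnth_mktuple /= permM permKV => ->.
Qed.

(** Orbits and stabilisers: by [wordP] and [young_wordP] the cosets correspond to the words of the
    given content, and the choice of representatives disappears. *)
Lemma dp_tensor_words :
  dp_tensor m n = \sum_(w : n.-tuple 'I_(size m) |
      word_content (fun j => nth 0%N (dp_exps m) j) w)
    tens [ffun i => nth 0 (unzip1 m) (tnth w i)].
Proof.
pose T (w : n.-tuple 'I_(size m)) : tpow V n :=
  tens [ffun i => nth 0 (unzip1 m) (tnth w i)].
set Y := young (dp_exps m) n; set L := lcosets Y [set: 'S_n].
have rep s : fingroup.repr (s *: Y)%g \in (s *: Y)%g.
  by apply: (mem_repr s); exact: lcoset_refl.
have repE C : C \in L -> C = (fingroup.repr C *: Y)%g.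
  by case/lcosetsP => s _ ->; apply/lcoset_eqP; rewrite lcoset_sym; exact: rep.
transitivity (\sum_(C in L) T (word (fingroup.repr C))).
  apply: eq_bigr => C _; rewrite tactE; congr tens; apply/ffunP => i.
  by rewrite !ffunE tnth_mktuple.
rewrite -(big_imset (h := fun C => word (fingroup.repr C)) T) /=; last first.
  move=> C1 C2 L1 L2 /young_wordP h; rewrite (repE _ L1) (repE _ L2).
  by apply/lcoset_eqP; rewrite lcoset_sym.
apply: eq_bigl => w; apply/imsetP/wordP => [[C _ ->]|[s ->]].
  by exists (fingroup.repr C).
exists (s *: Y)%g; first by apply/lcosetsP; exists s.
exact/young_wordP/rep.
Qed.
End Words.

Section HalfProducts.
Variables (F : comNzRingType) (A : Type).
Implicit Types (s : seq (shuffle F A)).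

Definition half_prod s : shuffle F A := foldr (@half_shuffle F A) 1 s.

Lemma half_prod_cons f s : half_prod (f :: s) = half_shuffle f (half_prod s).
Proof. by []. Qed.

(** In a shuffle the second factor receives a subword of [l], which is no longer than [l]. *)
Lemma shuffle_eval0 l (f g : shuffle F A) k :
  (forall l', (size l' < k)%N -> g l' = 0) -> (size l < k)%N -> shuffle_eval l f g = 0.
Proof.
elim: l f g k => [|a l IH] f g k g0 /= lt; first by rewrite g0 ?mulr0.
rewrite (IH _ _ k) ?(ltnW lt) // (IH _ _ k.-1) ?addr0 //; last by case: k lt {g0}.
by case: k lt g0 => // k _ g0 l' lt'; apply: g0.
Qed.

Lemma half_prod_short s l : (size l < size s)%N -> half_prod s l = 0.
Proof.
elim: s l => // f s IH [|a l] // lt; exact: (@shuffle_eval0 l _ _ (size s)).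
Qed.

Lemma big_tuple_cons (I : finType) (W : nmodType) n (P : pred (seq I)) (G : seq I -> W) :
  \sum_(w : n.+1.-tuple I | P w) G w =
  \sum_i \sum_(w : n.-tuple I | P (i :: w)) G (i :: w).
Proof.
rewrite pair_big_dep /=.
rewrite (reindex (fun p : I * n.-tuple I => [tuple of p.1 :: p.2])) //=.
exists (fun w : n.+1.-tuple I => (thead w, [tuple of behead w])).
  by move=> [i w] _; congr pair; apply: val_inj.
by move=> w _; rewrite [RHS]tuple_eta.
Qed.

Section WordSum.
Variables (k : nat) (a : 'I_k -> shuffle F A).
Implicit Types (r : 'I_k -> nat).

Lemma word_content_cons r i (w : seq 'I_k) : word_content r (i :: w) =
  (0 < r i)%N && word_content (fun j => r j - (j == i))%N w.
Proof.
apply/forallP/andP => [h|[ri /forallP h] j] /=; last first.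
  rewrite (eqP (h j)) (eq_sym i).
  by case: (j =P i) => [->|_]; rewrite ?subn0 // addnC subnK.
split; first by rewrite -(eqP (h i)) /= eqxx.
by apply/forallP => j; rewrite -(eqP (h j)) /= (eq_sym i) addKn.
Qed.

(** The product is the integral of its derivative, as some positive exponent makes its constant term
    vanish; the i-th term of the Leibniz rule integrates to the i-th half shuffle. *)
Lemma dpow_prod_half r : (0 < \sum_j r j)%N ->
  \prod_j dpow (a j) (r j) = \sum_(i | (0 < r i)%N)
     half_shuffle (a i) (\prod_j dpow (a j) (r j - (j == i))).
Proof.
move=> r0; apply: shuffle_ext => [|x].
  rewrite shuffle_sumE [RHS]big1 // shuffle_prod_nil.
  have [j rj] : exists j, r j != 0%N.
    apply/existsP; apply: contraTT r0; rewrite negb_exists => /forallP h.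
    by rewrite big1 // => j _; exact/eqP/negbNE/h.
  by rewrite (bigD1 j) //= dpow_nil (negbTE rj) mul0r.
rewrite shuffle_deriv_prod linear_sum [RHS]big_mkcond /=; apply: eq_bigr => i _.
case ri: (r i) => [|q] /=; first by rewrite dpow0 shuffle_deriv1 mul0r.
rewrite half_shuffle_deriv deriv_dpow -mulrA; congr (_ * _).
rewrite [RHS](bigD1 i) //= eqxx ri subn1 /=; congr (_ * _).
by apply: eq_bigr => j /negbTE ->; rewrite subn0.
Qed.

(** Splitting the words by their first letter gives the recursion of [dpow_prod_half]. No word of
    length n has content r unless the r_j add up to n, whence the case distinction. *)
Lemma sum_half_prod r n :
  \sum_(w : n.-tuple 'I_k | word_content r w) half_prod [seq a j | j <- w] =
  if n == (\sum_j r j)%N then \prod_j dpow (a j) (r j) else 0.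
Proof.
elim: n r => [|n IH] r.
  have c0 : word_content r [::] = (0%N == (\sum_j r j)%N).
    rewrite (eq_sym 0%N) sum_nat_eq0; apply: eq_forallb => j /=.
    by rewrite eq_sym.
  case: ifP => E; last by rewrite big1 // => w; rewrite (tuple0 w) /= c0 E.
  rewrite (big_pred1 [tuple]) => [|w]; last by rewrite (tuple0 w) /= c0 E eqxx.
  move: E; rewrite -c0 => /forallP h.
  by rewrite /= big1 // => j _; rewrite -(eqP (h j)).
rewrite (big_tuple_cons _ (word_content r) (fun w => half_prod [seq a j | j <- w])).
transitivity (\sum_(i | (0 < r i)%N) half_shuffle (a i)
    (if n.+1 == (\sum_j r j)%N then \prod_j dpow (a j) (r j - (j == i)) else 0)).
  rewrite [RHS]big_mkcond /=; apply: eq_bigr => i _.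
  case: ifP => ri; last by rewrite big_pred0 // => w; rewrite word_content_cons ri.
  under eq_bigl do rewrite word_content_cons ri /=.
  have E : (\sum_j r j = (\sum_j (r j - (j == i))).+1)%N.
    rewrite (bigD1 i) // [in RHS](bigD1 i) //= eqxx -addSn subn1 prednK //.
    by congr addn; apply: eq_bigr => j /negbTE ->; rewrite subn0.
  by rewrite E eqSS -IH linear_sum.
case: eqP => E; last by rewrite big1 // => i _; rewrite linear0.
by rewrite dpow_prod_half // -E.
Qed.
End WordSum.
End HalfProducts.
Arguments half_prod {F A} s : simpl never.

(** * Extension of a linear map to Gamma(V) *)

Section GammaLift.
Variables (F : fieldType) (V : lmodType F) (A : Type).
Variable f : {linear V -> shuffle F A}.

Definition gamma_word n (y : {ffun 'I_n -> V}) : shuffle F A :=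
  half_prod [seq f (y i) | i <- enum 'I_n].

Lemma gamma_word_multilinear n : multilinear (@gamma_word n).
Proof.
move=> y i c u v; rewrite /gamma_word.
have E s w : i \notin s -> [seq f (ffset y i w j) | j <- s] = [seq f (y j) | j <- s].
  move=> is_; apply/eq_in_map => j js; rewrite ffunE ifN //.
  by apply: contraNneq is_ => <-.
have: i \in enum 'I_n by rewrite mem_enum.
elim: (enum 'I_n) (enum_uniq 'I_n) => //= j s IH /andP[js us].
rewrite inE !half_prod_cons; case: eqP => [ij _|/eqP ij /= /(IH us) ->].
  rewrite -{}ij in js *; rewrite !E // !ffunE eqxx linearP.
  exact: half_shuffle_linearl.
by rewrite !ffunE eq_sym (negbTE ij) linearP.
Qed.

(** A word is seen only by the degrees up to its length ([half_prod_short]), so this truncated sum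
    is the sum over all degrees; the index n stands for degree n + 1. *)
Definition gamma_lift_fun (x : gamma V) : shuffle F A :=
  fun l => \sum_(n < size l) tlift (@gamma_word n.+1) (gamma_fam x n) l.

Fact gamma_lift_linear : linear gamma_lift_fun.
Proof.
move=> c x y; apply: funext => l.
rewrite shuffle_addE shuffle_scaleE /gamma_lift_fun mulr_sumr -big_split /=.
apply: eq_bigr => n _.
by rewrite [X in tlift _ X](_ : _ = c *: gamma_fam x n + gamma_fam y n) //
  (tlift_linear (@gamma_word_multilinear _)).
Qed.
Fact gamma_lift_subproof : {L : {linear gamma V -> shuffle F A} | forall x l,
  L x l = \sum_(n < size l) tlift (@gamma_word n.+1) (gamma_fam x n) l}.
Proof. by exists (mklin gamma_lift_linear). Qed.
Definition gamma_lift : {linear gamma V -> shuffle F A} := sval gamma_lift_subproof.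

Lemma gamma_liftE x l : gamma_lift x l =
  \sum_(n < size l) tlift (@gamma_word n.+1) (gamma_fam x n) l.
Proof. exact: (svalP gamma_lift_subproof). Qed.

Lemma tlift_dp_tensor (m : seq (V * nat)) n : n = sumn (dp_exps m) ->
  tlift (@gamma_word n) (dp_tensor m n) = \prod_(p <- m) dpow (f p.1) p.2.
Proof.
move=> En; pose T := mklin (tlift_linear (@gamma_word_multilinear n)).
rewrite -[tlift _ _]/(T _) dp_tensor_words // linear_sum /=.
transitivity (\sum_(w : n.-tuple 'I_(size m) |
    word_content (fun j => nth 0%N (dp_exps m) j) w)
    half_prod [seq f (nth 0 (unzip1 m) j) | j : 'I_(size m) <- w]).
  apply: eq_bigr => w _; rewrite [LHS](tliftE (@gamma_word_multilinear n)).
  rewrite /gamma_word -[in RHS](map_tnth_enum w) -map_comp.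
  by congr half_prod; apply: eq_map => i /=; rewrite ffunE.
rewrite (sum_half_prod (fun j : 'I__ => f (nth 0 (unzip1 m) j))).
rewrite ifT; last first.
  by rewrite En sumnE (big_nth 0%N) size_map big_mkord.
rewrite (big_nth (0, 0%N)) big_mkord; apply: eq_bigr => j _.
by rewrite !(nth_map (0, 0%N)).
Qed.

Lemma gamma_lift_dpm (m : seq (V * nat)) : (0 < sumn (dp_exps m))%N ->
  gamma_lift (dpm m) = \prod_(p <- m) dpow (f p.1) p.2.
Proof.
set N := sumn _ => N0; apply: funext => l; rewrite gamma_liftE.
pose T n := mklin (tlift_linear (@gamma_word_multilinear n)).
have Z n : n.+1 != N -> tlift (@gamma_word n.+1) (dp_comp m n.+1) = 0.
  by move=> nN; rewrite /dp_comp (negbTE nN); exact: (linear0 (T n.+1)).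
have Y n : n.+1 = N -> tlift (@gamma_word n.+1) (dp_comp m n.+1) =
    \prod_(p <- m) dpow (f p.1) p.2.
  by move=> nN; rewrite /dp_comp [n.+1 == _](introT eqP nN); exact: tlift_dp_tensor.
have [le|lt] := leqP N (size l).
  have lt : (N.-1 < size l)%N by rewrite prednK.
  rewrite (bigD1 (Ordinal lt)) //= Y ?prednK // [X in _ + X]big1 ?addr0 // => n.
  rewrite -val_eqE /= => nN; rewrite Z //.
  by apply: contraNneq nN => <-.
(* On a word shorter than the degree no summand on the left survives. The right side vanishes too,
   being a sum of half products with more factors than the word has letters. *)
rewrite [LHS]big1 => [|n _]; last by rewrite Z // neq_ltn (leq_ltn_trans _ lt).
have := sum_half_prod (fun j : 'I_(size m) => f (nth 0 (unzip1 m) j))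
   (fun j => nth 0%N (dp_exps m) j) N.
rewrite ifT; last by rewrite /N sumnE (big_nth 0%N) size_map big_mkord.
move=> /(congr1 (fun z : shuffle F A => z l)).
rewrite shuffle_sumE big1 => [->|w _]; last first.
  by rewrite half_prod_short // size_map size_tuple.
rewrite (big_nth (0, 0%N)) big_mkord; congr (_ l); apply: eq_bigr => j _.
by rewrite !(nth_map (0, 0%N)).
Qed.
End GammaLift.
Arguments gamma_lift {F V A} f : simpl never.

(** * Spanning sets and dual bases *)

Section Span.
Variables (F : fieldType).
Implicit Types V W : lmodType F.

Inductive span V (P : V -> Prop) : V -> Prop :=
| Span0 : span P 0
| SpanC c x y : P x -> span P y -> span P (c *: x + y).

Lemma span_mem V (P : V -> Prop) x : P x -> span P x.
Proof. by move=> Px; rewrite -[x]addr0 -[x]scale1r; apply: SpanC => //; exact: Span0. Qed.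

Lemma spanP V (P : V -> Prop) c x y : span P x -> span P y -> span P (c *: x + y).
Proof.
move=> Px Py; elim: Px => [|c' u v Pu _ IH]; first by rewrite scaler0 add0r.
by rewrite scalerDr scalerA -addrA; exact: SpanC.
Qed.

Lemma span_sum V (P : V -> Prop) I (r : seq I) (Q : pred I) (G : I -> V) :
  (forall i, Q i -> span P (G i)) -> span P (\sum_(i <- r | Q i) G i).
Proof.
move=> PG; elim/big_rec: _ => [|i x Qi Px]; first exact: Span0.
by rewrite -[G i]scale1r; apply: spanP => //; exact: PG.
Qed.

Lemma spanZ V (P : V -> Prop) c x : span P x -> span P (c *: x).
Proof. by move=> Px; rewrite -[_ *: _]addr0; apply: spanP => //; exact: Span0. Qed.

Lemma span_trans V (P Q : V -> Prop) x :
  (forall y, P y -> span Q y) -> span P x -> span Q x.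
Proof.
move=> PQ; elim=> [|c y z Py _ Qz]; first exact: Span0.
by apply: spanP => //; exact: PQ.
Qed.

Lemma span_eq V W (f g : {linear V -> W}) (P : V -> Prop) x :
  (forall y, P y -> f y = g y) -> span P x -> f x = g x.
Proof.
move=> fg; elim=> [|c y z Py _ fgz]; first by rewrite !linear0.
by rewrite !linearP fgz fg.
Qed.

Lemma span_finite V (P : V -> Prop) (vs : seq V) : (forall v, span P v) ->
  exists s : seq V, (forall x, x \in s -> P x) /\
    (forall v, v \in vs -> span (fun x => x \in s) v).
Proof.
move=> PV; elim: vs => [|v vs [s [sP svs]]]; first by exists [::].
have [t [tP tv]] : exists t : seq V, (forall x, x \in t -> P x) /\
    span (fun x => x \in t) v.
  elim: (PV v) => [|c x y Px _ [t [tP ty]]]; first by exists [::]; split=> //; exact: Span0.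
  exists (x :: t); split=> [z|]; first by rewrite inE => /orP[/eqP->|/tP].
  apply: SpanC; rewrite ?mem_head //.
  by apply: span_trans ty => z zt; apply: span_mem; rewrite inE zt orbT.
exists (s ++ t); split=> [x|x]; first by rewrite mem_cat => /orP[/sP|/tP].
rewrite inE => /orP[/eqP->|/svs]; last move: tv => _ tv.
  by apply: span_trans tv => z zt; apply: span_mem; rewrite mem_cat zt orbT.
by apply: span_trans tv => z zs; apply: span_mem; rewrite mem_cat zs.
Qed.
End Span.

Section Duals.
Variables (F : fieldType) (V : lmodType F).

Definition dual : Type := {linear V -> F^o}.

Lemma dualZ (phi : dual) c v : phi (c *: v) = c * phi v.
Proof. exact: linearZ. Qed.

(* The kernel of the functional is a maximal subspace avoiding [v]. *)
Lemma separating_functional (v : V) : v != 0 -> exists phi : dual, phi v = 1.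
Proof.
move=> v0; pose closed (H : set V) := forall c x y, H x -> H y -> H (c *: x + y).
pose P : set (set V) := fun H => closed H /\ ~ H v.
have [C CP tot|H [[Hc Hv] Hmax]] := @Zorn_bigcup V P.
  split=> [c x y [X CX Xx] [Y CY Yy]|[X CX Xv]]; last by case: (CP X CX).
  by have [XY|YX] := tot X Y CX CY; [exists Y|exists X] => //;
    [apply: (CP Y CY).1|apply: (CP X CX).1] => //; [exact: XY|exact: YX].
(* [closed] does not ask for 0, since the union of the empty chain is empty. An [H] without 0 would
   be empty, and then the zero subspace would be larger. *)
have H0 : H 0.
  apply: contrapT => nH0; have He x : ~ H x.
    by move=> Hx; apply: nH0; have := Hc (-1) x x Hx Hx; rewrite scaleN1r addNr.
  apply: (Hmax (fun x => x = 0)).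
    by split=> [x /He //|sub]; apply: nH0; exact: sub.
  split=> [c x y -> ->|/esym/eqP]; first by rewrite scaler0 addr0.
  by rewrite eq_sym (negbTE v0).
have HZ c x : H x -> H (c *: x).
  by move=> Hx; rewrite -[_ *: _]addr0; exact: Hc.
(* By maximality [H] and [v] span the space: otherwise [B], spanned by [H] and [x], would be larger
   and still avoid [v]. *)
have ex x : exists c, H (x - c *: v).
  apply: contrapT => nex.
  have nHx c : ~ H (x - c *: v) by move=> h; apply: nex; exists c.
  pose B : set V := fun z => exists y c, H y /\ z = y + c *: x.
  apply: (Hmax B).
    split=> [y Hy|sub]; first by exists y, 0; rewrite scale0r addr0.
    apply: (nHx 0); rewrite scale0r subr0; apply: sub.
    by exists 0, 1; rewrite scale1r add0r.
  split=> [c _ _ [y [a [Hy ->]]] [z [b [Hz ->]]]|[y [c [Hy vE]]]].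
    exists (c *: y + z), (c * a + b); split; first exact: Hc.
    by rewrite scalerDr scalerDl scalerA addrACA.
  have [c0|c0] := eqVneq c 0.
    by apply: Hv; rewrite vE c0 scale0r addr0.
  apply: (nHx c^-1); rewrite vE scalerDr scalerA mulVf // scale1r opprD addrCA subrr addr0.
  by rewrite -scaleNr; exact: HZ.
have uniq x c c' : H (x - c *: v) -> H (x - c' *: v) -> c = c'.
  move=> h h'; apply/eqP; rewrite -subr_eq0; apply/negP => /negP d0; apply: Hv.
  have := HZ (c - c')^-1 _ (Hc (-1) _ _ h h').
  rewrite scaleN1r opprB addrA subrK -scalerBl scalerA mulVf ?scale1r //.
pose phi x : F^o := sval (cid (ex x)).
have phiP x : H (x - phi x *: v) by rewrite /phi; case: cid.
have phi_linear : linear phi.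
  move=> c x y; apply: (uniq (c *: x + y)) => //.
  have := Hc c _ _ (phiP x) (phiP y); congr H.
  rewrite scalerBr [(c *: phi x + phi y) *: v]scalerDl opprD addrACA.
  by rewrite scalerA.
exists (mklin phi_linear); apply: (uniq v); first exact: phiP.
by rewrite scale1r subrr.
Qed.

(** Gram-Schmidt with functionals. A vector x of the list is added when its remainder x' is nonzero;
    a functional separating x' from 0 is corrected to vanish on the earlier vectors, and the earlier
    functionals are corrected to vanish on x. *)
Lemma dual_basis (P : V -> Prop) (vs : seq V) : (forall v, span P v) ->
  exists d (e : 'I_d -> V) (phi : 'I_d -> dual),
    [/\ forall i, P (e i), forall i j, phi i (e j) = (i == j)%:R &
        forall v, v \in vs -> v = \sum_i phi i v *: e i].
Proof.
move=> PV; have [s [sP svs]] := span_finite vs PV.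
suff [d [e [phi [eP ephi es]]]] : exists d (e : 'I_d -> V) (phi : 'I_d -> dual),
    [/\ forall i, P (e i), forall i j, phi i (e j) = (i == j)%:R &
        forall v, v \in s -> v = \sum_i phi i v *: e i].
  exists d, e, phi; split=> // v /svs vs_s.
  have lin : linear (fun v => \sum_i phi i v *: e i).
    move=> c x y; rewrite scaler_sumr -big_split; apply: eq_bigr => i _ /=.
    by rewrite linearP scalerDl scalerA.
  exact: (span_eq (f := idfun) (g := mklin lin)) vs_s.
elim: s sP {svs} => [|x s IH] sP.
  by exists 0%N, (fun=> 0), (fun=> \0); split=> // -[].
have [|d [e [phi [eP ephi es]]]] := IH; first by move=> y ys; apply: sP; rewrite inE ys orbT.
pose x' := x - \sum_i phi i x *: e i.
have [x0|x0] := eqVneq x' 0.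
  exists d, e, phi; split=> // v; rewrite inE => /orP[/eqP->|/es //].
  by apply/eqP; rewrite -subr_eq0 -/x' x0.
have phi_x' i : phi i x' = 0.
  rewrite linearB linear_sum (bigD1 i) //= dualZ ephi eqxx mulr1.
  rewrite big1 ?addr0 ?subrr // => j ji; rewrite dualZ ephi eq_sym (negbTE ji).
  exact: mulr0.
have [psi psix'] := separating_functional x0.
have psi'_lin : linear (fun v => psi v - \sum_i psi (e i) * phi i v : F^o).
  move=> c u v; rewrite linearP scalerBr addrACA -opprD scaler_sumr -big_split.
  congr (_ - _); apply: eq_bigr => i _; rewrite linearP mulrDr.
  by congr (_ + _); exact: mulrCA.
pose psi' : dual := mklin psi'_lin.
have psi'e i : psi' (e i) = 0.
  rewrite -[LHS]/(_ - _) (bigD1 i) //= ephi eqxx mulr1 big1 ?addr0 ?subrr //.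
  by move=> j ji; rewrite ephi (negbTE ji) mulr0.
have psi'x' : psi' x' = 1.
  rewrite -[LHS]/(_ - _) psix' big1 ?subr0 // => i _.
  by rewrite phi_x' mulr0.
have psi'x : psi' x = 1.
  rewrite -psi'x' linearB linear_sum big1 ?subr0 // => i _.
  by rewrite dualZ psi'e mulr0.
have phi'_lin i : linear (fun v => phi i v - phi i x * psi' v : F^o).
  move=> c u v; rewrite [phi i (_ + _)]linearD [psi' (_ + _)]linearD !dualZ.
  rewrite -[RHS]/(c * (phi i u - phi i x * psi' u) + (phi i v - phi i x * psi' v)).
  by ring.
(* The new basis vector is x and not its remainder x', which need not satisfy [P]. *)
pose e' (i : 'I_d.+1) : V := if unlift ord0 i is Some j then e j else x.
pose phi' (i : 'I_d.+1) : dual :=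
  if unlift ord0 i is Some j then mklin (phi'_lin j) else psi'.
exists d.+1, e', phi'; split=> [i|i j|v].
- rewrite /e'; case: unliftP => [j _|_]; [exact: eP|by apply: sP; rewrite mem_head].
- rewrite /phi' /e'; case: unliftP => [i' ->|->]; case: unliftP => [j' ->|->].
  + rewrite -[LHS]/(_ - _) psi'e mulr0 subr0 ephi.
    by rewrite (inj_eq lift_inj).
  + by rewrite -[LHS]/(_ - _) psi'x mulr1 subrr.
  + by rewrite psi'e.
  + by rewrite psi'x.
- have -> : \sum_i phi' i v *: e' i = psi' v *: x' + \sum_i phi i v *: e i.
    rewrite big_ord_recl /phi' /e' unlift_none scalerBr -addrA; congr (_ + _).
    rewrite addrC scaler_sumr -sumrB; apply: eq_bigr => i _; rewrite liftK.
    by rewrite -[mklin _ v]/(phi i v - phi i x * psi' v) scalerBl scalerA mulrC.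
  rewrite inE => /orP[/eqP ->|vs_]; first by rewrite psi'x scale1r subrK.
  rewrite {2}(es v vs_) linear_sum big1 ?scale0r ?add0r; first exact: es.
  by move=> i _; rewrite dualZ psi'e mulr0.
Qed.
End Duals.

(** * The embedding of Gamma(V) into functions of words in functionals *)

Section GammaEval.
Variables (F : fieldType) (V : lmodType F).

Definition point_fun (v : V) : shuffle F (dual V) :=
  fun l => if l is [:: phi] then phi v else 0.
Fact point_linear : linear point_fun.
Proof.
move=> c u v; apply: funext => -[|phi [|? ?]];
  rewrite shuffle_addE shuffle_scaleE ?mulr0 ?addr0 //.
exact: linearP.
Qed.
Definition point : {linear V -> shuffle F (dual V)} := mklin point_linear.

Lemma deriv_point phi v : shuffle_deriv phi (point v) = phi v *: 1.
Proof.
by apply: funext => -[|? ?]; rewrite shuffle_scaleE shuffle_1E ?mulr1 ?mulr0.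
Qed.

Lemma half_prod_point_cons v s phi l :
  half_prod (point v :: s) (phi :: l) = phi v * half_prod s l.
Proof.
rewrite half_prod_cons -[LHS]/((shuffle_deriv phi (point v) * half_prod s) l).
by rewrite deriv_point -scalerAl mul1r.
Qed.

Lemma half_prod_point_size s l : size l != size s ->
  half_prod [seq point v | v <- s] l = 0.
Proof.
elim: s l => [|v s IH] [|phi l] //= ls.
by rewrite half_prod_point_cons IH ?mulr0.
Qed.

(* [gamma_eval x [:: phi_1; ..; phi_n]] is the value of the degree [n] component
   of [x] under phi_1 (x) .. (x) phi_n. *)
Definition gamma_eval : {linear gamma V -> shuffle F (dual V)} := gamma_lift point.

Let word_lin n := mklin (tlift_linear (@gamma_word_multilinear F V _ point n)).

Let word_linZ n a t l : word_lin n (a *: t) l = a * word_lin n t l.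
Proof. by rewrite linearZ. Qed.

Lemma gamma_word_size n (t : tpow V n) l : size l != n -> tlift (@gamma_word F V _ point n) t l = 0.
Proof.
move=> ln; case: (tens_span t) => s ->.
rewrite -[tlift _ _]/(word_lin n _) linear_sum shuffle_sumE big1 // => p _.
rewrite linearZ /= shuffle_scaleE [tlift _ _](tliftE (@gamma_word_multilinear F V _ point n)).
rewrite /gamma_word map_comp half_prod_point_size ?mulr0 //.
by rewrite size_map size_enum_ord.
Qed.

Lemma gamma_evalE x n l : size l = n.+1 ->
  gamma_eval x l = tlift (@gamma_word F V _ point n.+1) (gamma_fam x n) l.
Proof.
move=> ln; rewrite gamma_liftE ln big_ord_recr /= big1 ?add0r // => k _.
by rewrite gamma_word_size // ln eqSS gtn_eqF.
Qed.

Section DualWords.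
Variables (d : nat) (e : 'I_d -> V) (phi : 'I_d -> dual V).
Hypothesis phie : forall i j, phi i (e j) = (i == j)%:R.

Lemma half_prod_dual (w w' : seq 'I_d) :
  half_prod [seq point (e j) | j <- w] [seq phi j | j <- w'] = (w == w')%:R.
Proof.
elim: w w' => [|j w IH] [|j' w'] //=.
by rewrite half_prod_point_cons IH phie eqseq_cons (eq_sym j) -natrM mulnb.
Qed.

Lemma gamma_word_dual n (w w' : n.-tuple 'I_d) :
  tlift (@gamma_word F V _ point n) (tens [ffun i => e (tnth w i)]) [seq phi j | j <- w'] =
  (w == w')%:R.
Proof.
rewrite (tliftE (@gamma_word_multilinear F V _ point n)) -val_eqE /= -half_prod_dual.
rewrite /gamma_word -[in RHS](map_tnth_enum w) -map_comp.
by congr (half_prod _ _); apply: eq_map => i /=; rewrite ffunE.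
Qed.
End DualWords.

Lemma tens_in_span d (e : 'I_d -> V) n (y : {ffun 'I_n -> V}) :
  (forall i, exists c : 'I_d -> F, y i = \sum_j c j *: e j) ->
  span (fun t => exists w : n.-tuple 'I_d, t = tens [ffun i => e (tnth w i)]) (tens y).
Proof.
move=> ye.
(* The coordinates are expanded one at a time, from the last to the first; those of index at least k
   are already among the [e j]. *)
suff H k : (k <= n)%N -> forall y : {ffun 'I_n -> V},
    (forall i, exists c : 'I_d -> F, y i = \sum_j c j *: e j) ->
    (forall i : 'I_n, (k <= i)%N -> exists j, y i = e j) ->
    span (fun t => exists w : n.-tuple 'I_d, t = tens [ffun i => e (tnth w i)]) (tens y).
  by apply: (H n) => // i; rewrite leqNgt ltn_ord.
elim: k => [|k IH] kn {}y {}ye yk.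
  have /choice[g gE] : forall i, exists j, y i = e j by move=> i; exact: yk.
  apply: span_mem; exists [tuple g i | i < n]; congr tens; apply/ffunP => i.
  by rewrite ffunE tnth_mktuple.
pose i0 := Ordinal kn; have [c yi0] := ye i0.
pose T (v : V) := tens (ffset y i0 v).
have T_lin : linear T by move=> a u v; exact: tens_multilinear.
have -> : y = ffset y i0 (\sum_j c j *: e j).
  by apply/ffunP => i; rewrite ffunE; case: eqP => // ->.
rewrite -[tens _]/(mklin T_lin _) linear_sum; apply: span_sum => j _.
rewrite linearZ; apply: spanZ; apply: IH => [|i|i]; first exact: ltnW.
  rewrite ffunE; case: eqP => _ //.
  exists (fun j' => (j' == j)%:R); rewrite (bigD1 j) //= eqxx scale1r big1 ?addr0 //.
  by move=> j' /negbTE ->; rewrite scale0r.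
rewrite ffunE; case: eqP => [_ _|/eqP ii0 ki]; first by exists j.
by apply: yk; rewrite ltn_neqAle ki eq_sym -val_eqE in ii0 *; rewrite ii0.
Qed.

(** Only finitely many vectors occur in [t], so a finite dual basis taken from [P] expands it. *)
Lemma tpow_words (P : V -> Prop) n (t : tpow V n) : (forall v, span P v) ->
  exists d (e : 'I_d -> V) (phi : 'I_d -> dual V) (c : n.-tuple 'I_d -> F),
    [/\ forall i, P (e i), forall i j, phi i (e j) = (i == j)%:R &
        t = \sum_w c w *: tens [ffun i => e (tnth w i)]].
Proof.
move=> PV; have [s Es] := tens_span t.
have [d [e [phi [eP ephi es]]]] := dual_basis [seq p.2 i | p : _ * {ffun 'I_n -> V} <- s, i <- enum 'I_n] PV.
exists d, e, phi.
suff [c Ec] : exists c : n.-tuple 'I_d -> F, t = \sum_w c w *: tens [ffun i => e (tnth w i)].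
  by exists c.
have : span (fun t => exists w : n.-tuple 'I_d, t = tens [ffun i => e (tnth w i)]) t.
  rewrite Es big_seq; apply: span_sum => p ps; apply: spanZ; apply: tens_in_span => // i.
  exists (fun j => phi j (p.2 i)); apply: es; apply/allpairsP.
  by exists (p, i); rewrite ps mem_enum.
elim=> [|a x y [w ->] _ [c ->]].
  by exists (fun=> 0); rewrite big1 // => w _; rewrite scale0r.
exists (fun w' => a * (w' == w)%:R + c w').
under [RHS]eq_bigr do rewrite scalerDl.
rewrite big_split /=; congr (_ + _); rewrite (bigD1 w) //= eqxx mulr1 big1 ?addr0 //.
by move=> w' /negbTE ->; rewrite mulr0 scale0r.
Qed.

(** The coefficient of a word in basis vectors is the value at the word in the dual functionals, so
    all coefficients of an element of the kernel vanish. *)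
Lemma gamma_eval_inj : injective gamma_eval.
Proof.
suff K x : gamma_eval x = 0 -> x = 0.
  by move=> x y xy; apply/eqP; rewrite -subr_eq0; apply/eqP/K; rewrite linearB xy subrr.
move=> x0; apply: gamma_ext => n; rewrite -[RHS]/(0 : tpow V n.+1).
have [|d [e [phi [c [_ ephi Ex]]]]] := @tpow_words (fun=> True) _ (gamma_fam x n).
  by move=> v; exact: span_mem.
rewrite Ex big1 // => w _.
suff -> : c w = 0 by rewrite scale0r.
have := congr1 (fun z : shuffle F _ => z [seq phi j | j <- w]) x0.
rewrite (@gamma_evalE x n) ?size_map ?size_tuple // Ex -[tlift _ _]/(word_lin n.+1 _).
rewrite linear_sum shuffle_sumE (bigD1 w) // word_linZ.
rewrite [word_lin _ _ _](gamma_word_dual ephi) eqxx mulr1 big1 => [|w' /negbTE ww']; first by rewrite /= addr0.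
by rewrite [LHS]word_linZ [word_lin _ _ _](gamma_word_dual ephi) ww' mulr0.
Qed.
End GammaEval.
Arguments point {F V}.
Arguments gamma_eval {F V} : simpl never.

Lemma dp_wf_sumn (T : Type) (m : seq (T * nat)) :
  dp_wf m -> (0 < sumn [seq p.2 | p <- m])%N.
Proof. by case: m => // p m /andP[_ /=] /andP[p0 _]; rewrite ltn_addr. Qed.

(** * Divided power monomials span Gamma(V) *)

Section GammaSpan.
Variables (F : fieldType) (V : lmodType F).

Lemma gamma_eval_dpm (m : seq (V * nat)) : (0 < sumn (dp_exps m))%N ->
  gamma_eval (dpm m) = \prod_(p <- m) dpow (point p.1) p.2.
Proof. exact: gamma_lift_dpm. Qed.

Lemma count_mem_perm (I : finType) n (w w' : n.-tuple I) :
  (forall i, count_mem i w = count_mem i w') ->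
  exists s : 'S_n, w = [tuple tnth w' (s i) | i < n].
Proof.
move=> ww'; have /tuple_permP[s Ew] : perm_eq w w'.
  by apply/allP => i _ /=; rewrite ww'.
by exists s; apply: val_inj.
Qed.

(** The coefficient of a word is the value of [t] at the dual word, and invariance allows [t] to be
    expanded along the permuted words as well. *)
Lemma coef_sym d (e : 'I_d -> V) (phi : 'I_d -> dual V) n (c : n.-tuple 'I_d -> F)
    (t : tpow V n) : (forall i j, phi i (e j) = (i == j)%:R) ->
  t = \sum_w c w *: tens [ffun i => e (tnth w i)] ->
  (forall s, tact s t = t) ->
  forall w w' : n.-tuple 'I_d, (forall j, count_mem j w = count_mem j w') -> c w = c w'.
Proof.
move=> phie Et ts w w' /count_mem_perm[s ->].
set w1 := [tuple _ | _ < _].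
pose L := mklin (tlift_linear (@gamma_word_multilinear F V _ point n)).
have LZ a x l : L (a *: x) l = a * L x l by rewrite linearZ.
have LE (u v : n.-tuple 'I_d) : L (tens [ffun i => e (tnth u i)]) [seq phi j | j <- v] = (u == v)%:R.
  exact: (gamma_word_dual phie).
have Es : t = \sum_w c w *: tens [ffun i => e (tnth [tuple tnth w (s i) | i < n] i)].
  rewrite -(ts s) [in LHS]Et linear_sum; apply: eq_bigr => u _.
  rewrite linearZ /= tactE; congr (_ *: tens _).
  by apply/ffunP => i; rewrite !ffunE tnth_mktuple.
have Lw1 : L t [seq phi j | j <- w1] = c w1.
  rewrite [in LHS]Et linear_sum shuffle_sumE (bigD1 w1) // LZ LE eqxx mulr1.
  rewrite big1 => [/=|u /negbTE uw]; first by rewrite addr0.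
  by rewrite [LHS]LZ LE uw mulr0.
rewrite -Lw1 Es linear_sum shuffle_sumE (bigD1 w') // LZ LE eqxx mulr1.
rewrite big1 => [/=|u uw']; first by rewrite addr0.
rewrite [LHS]LZ LE (_ : (_ == _) = false) ?mulr0 //.
apply: contraNF uw' => /eqP uw; apply/eqP/eq_from_tnth => i.
have := congr1 (fun v => tnth v ((s^-1)%g i)) uw.
by rewrite !tnth_mktuple permKV.
Qed.

(** In each degree the words are grouped by content. Symmetry makes the coefficients constant on
    each group, and the sum of a group is a divided power monomial. The freedom in [P] serves
    Gamma(Gamma(V)), where the factors are to be monomials themselves. *)
Lemma gamma_span (P : V -> Prop) (x : gamma V) : (forall v, span P v) ->
  span (fun y => exists m : seq (V * nat),
    [/\ dp_wf m, forall p, p \in m -> P p.1 & y = dpm m]) x.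
Proof.
move=> PV; set Q := fun y => _.
pose gw n := tlift (@gamma_word F V _ point n).
have H n : exists2 y, span Q y & gamma_eval y = gw n.+1 (gamma_fam x n).
  have [d [e [phi [c [eP ephi Et]]]]] := tpow_words (gamma_fam x n) PV.
  have c_sym := coef_sym ephi Et.
  have /c_sym {}c_sym : forall s, tact s (gamma_fam x n) = gamma_fam x n.
    by case: x @gw {Et c_sym} => x /= /asboolP[].
  (* Contents are taken with values at most n + 1, so that they form a finite type. Absent letters
     are dropped because exponents must be positive. *)
  pose mon (r : {ffun 'I_d -> 'I_n.+2}) := [seq (e j, r j : nat) | j <- enum 'I_d & (0 < r j)%N].
  pose cont (w : n.+1.-tuple 'I_d) : {ffun 'I_d -> 'I_n.+2} := [ffun j => inord (count_mem j w)].
  have contE w j : cont w j = count_mem j w :> nat.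
    by rewrite ffunE inordK // ltnS -[X in (_ <= X)%N](size_tuple w) count_size.
  have sum_mon r : sumn (dp_exps (mon r)) = (\sum_j r j)%N.
    rewrite /dp_exps -map_comp sumnE big_map big_filter big_mkcond /= big_enum /=.
    by apply: eq_bigr => j _; case: (r j : nat).
  have prod_mon r : \prod_(p <- mon r) dpow (point p.1) p.2 =
      \prod_j dpow (point (e j)) (r j).
    rewrite big_map big_filter big_mkcond /= big_enum /=.
    by apply: eq_bigr => j _; case: (r j : nat).
  (* The common coefficient of the words of content [r], and 0 if there is no such word. *)
  pose b (r : {ffun 'I_d -> 'I_n.+2}) :=
    if n.+1 == (\sum_j r j)%N then if [pick w | cont w == r] is Some w then c w else 0 else 0.
  exists (\sum_r b r *: dpm (mon r)).
    apply: span_sum => r _; rewrite /b; case: eqP => E; last by rewrite scale0r; exact: Span0.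
    apply/spanZ/span_mem; exists (mon r); split=> //; last first.
      by move=> _ /mapP[j _ ->]; exact: eP.
    apply/andP; split; last by apply/allP => _ /mapP[j jr ->]; move: jr; rewrite mem_filter => /andP[].
    by case: (mon r) (sum_mon r) => //; rewrite -E.
  pose L := mklin (tlift_linear (@gamma_word_multilinear F V _ point n.+1)).
  have LE (w : n.+1.-tuple 'I_d) : L (tens [ffun i => e (tnth w i)]) =
      half_prod [seq point (e j) | j <- w].
    rewrite [LHS](tliftE (@gamma_word_multilinear F V _ point n.+1)).
    rewrite /gamma_word -[in RHS](map_tnth_enum w) -map_comp.
    by congr half_prod; apply: eq_map => i /=; rewrite ffunE.
  rewrite Et /gw -[tlift _ _]/(L _).
  rewrite !linear_sum [RHS](partition_big cont predT) //; apply: eq_bigr => r _.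
  transitivity (b r *: \sum_(w | cont w == r) half_prod [seq point (e j) | j <- w]).
    have -> : \sum_(w | cont w == r) half_prod [seq point (e j) | j <- w] =
        if n.+1 == (\sum_j r j)%N then \prod_j dpow (point (e j)) (r j) else 0.
      rewrite -sum_half_prod; apply: eq_bigl => w.
      apply/eqP/forallP => [<- j|h]; first by rewrite contE.
      by apply/ffunP => j; apply: val_inj; rewrite /= contE (eqP (h j)).
    rewrite [LHS]linearZ /b; case: eqP => E; last by rewrite /= !scale0r.
    by rewrite gamma_eval_dpm ?sum_mon -?E // prod_mon.
  rewrite scaler_sumr; apply: eq_bigr => w /eqP wr.
  rewrite [RHS]linearZ LE /=.
  congr (_ *: _); rewrite /b ifT.
    case: pickP => [w'|/(_ w)]; last by rewrite wr eqxx.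
    move/eqP => w'r; apply: c_sym => j.
    by rewrite -!contE wr w'r.
  have -> : (\sum_j r j = \sum_j count_mem j w)%N.
    by apply: eq_bigr => j _; rewrite -wr contE.
  apply/eqP; rewrite -[LHS](size_tuple w) -sum1_size (partition_big id predT) //=.
  by apply: eq_bigr => j _; rewrite sum1_count.
have /choice[y yE] : forall n, exists y, span Q y /\ gamma_eval y = gw n.+1 (gamma_fam x n).
  by move=> n; have [y] := H n; exists y.
have [N xN] : exists N, forall n, (N <= n)%N -> gamma_fam x n = 0.
  by case: x {gw H yE} => x /= /asboolP[].
suff -> : x = \sum_(n < N) y n by apply: span_sum => n _; case: (yE n).
apply: gamma_eval_inj; apply: funext => l; rewrite linear_sum shuffle_sumE.
(* The sums over n < N and over n < [size l] agree: beyond N the components of x vanish, and beyond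
   the length of the word the degree is too large. *)
have gw0 n : (N <= n)%N \/ (size l <= n)%N -> gw n.+1 (gamma_fam x n) l = 0.
  case=> [/xN ->|ln]; last by apply: gamma_word_size; rewrite neq_ltn ltnS ln.
  rewrite /gw -[tlift _ _]/(mklin (tlift_linear (@gamma_word_multilinear F V _ point n.+1)) _).
  by rewrite linear0.
under eq_bigr => n _ do rewrite (yE n).2.
rewrite gamma_liftE -!(big_mkord predT (fun n => gw n.+1 (gamma_fam x n) l)).
have [le|/ltnW le] := leqP N (size l).
  rewrite (big_cat_nat (leq0n _) le) /= [X in _ + X]big_nat [X in _ + X]big1 ?addr0 // => n /andP[Nn _].
  by rewrite gw0 //; left.
rewrite (big_cat_nat (leq0n _) le) /= [X in _ + X]big_nat [X in _ + X]big1 ?addr0 // => n /andP[Nn _].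
by rewrite gw0 //; right.
Qed.
End GammaSpan.

(** * The operations of the divided power monad *)

Section GammaOperations.
Variable F : fieldType.
Implicit Types V W : lmodType F.

Definition dpm2 V (mm : seq (seq (V * nat) * nat)) : gamma (gamma V) :=
  dpm [seq (dpm p.1, p.2) | p <- mm].

Lemma gamma_span_dpm V (x : gamma V) :
  span (fun y => exists2 m : seq (V * nat), dp_wf m & y = dpm m) x.
Proof.
have Vs (v : V) : span (fun=> True) v by exact: span_mem.
apply: span_trans (gamma_span x Vs) => _ [m [mw _ ->]].
by apply: span_mem; exists m.
Qed.

Lemma gamma_span_dpm2 V (x : gamma (gamma V)) :
  span (fun y => exists mm : seq (seq (V * nat) * nat),
    [/\ dp_wf mm, all (fun p => dp_wf p.1) mm & y = dpm2 mm]) x.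
Proof.
apply: span_trans (gamma_span x (@gamma_span_dpm V)) => _ [M [Mw MP ->]].
suff [mm [mmw EM]] : exists mm : seq (seq (V * nat) * nat),
    all (fun p => dp_wf p.1) mm /\ M = [seq (dpm p.1, p.2) | p <- mm].
  apply: span_mem; exists mm; rewrite /dpm2 -EM; split=> //.
  move: Mw; rewrite EM /dp_wf size_map => /andP[-> /=].
  by rewrite all_map.
elim: M MP {Mw} => [|[y r] M IH] MP; first by exists [::].
have [m mw /= ym] := MP (y, r) (mem_head _ _).
have [|mm [mmw ->]] := IH; first by move=> p pM; apply: MP; rewrite inE pM orbT.
by exists ((m, r) :: mm); rewrite /= mw mmw -ym.
Qed.

Lemma gamma_lin_ext V W (f g : {linear gamma V -> W}) :
  (forall m, dp_wf m -> f (dpm m) = g (dpm m)) -> f =1 g.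
Proof.
by move=> fg x; apply: span_eq (gamma_span_dpm x) => _ [m mw ->]; exact: fg.
Qed.

Lemma gamma2_lin_ext V W (f g : {linear gamma (gamma V) -> W}) :
  (forall mm, dp_wf mm -> all (fun p => dp_wf p.1) mm -> f (dpm2 mm) = g (dpm2 mm)) ->
  f =1 g.
Proof.
move=> fg x; apply: span_eq (gamma_span_dpm2 x) => _ [mm [w w' ->]]; exact: fg.
Qed.

(** Monomials span but satisfy relations, so a formula on them need not define a map. A linear map
    [L] into functions of words that sends a spanning set into the image of the injective
    [gamma_eval] does factor through it; this is how mu and d are constructed. *)
Lemma gamma_factor V W (L : {linear gamma V -> shuffle F (dual W)})
    (P : gamma V -> Prop) :
  (forall x, span P x) -> (forall x, P x -> exists y, gamma_eval y = L x) ->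
  exists f : {linear gamma V -> gamma W}, forall x, gamma_eval (f x) = L x.
Proof.
move=> PV PL; have /choice[f fE] : forall x, exists y, gamma_eval y = L x.
  move=> x; elim: (PV x) => [|c u v /PL[y yE] _ [z zE]].
    by exists 0; rewrite !linear0.
  by exists (c *: y + z); rewrite !linearP yE zE.
have flin : linear f.
  by move=> c x y; apply: gamma_eval_inj; rewrite linearP !fE linearP.
by exists (mklin flin).
Qed.

Lemma mu_monomial_sumn V (mm : seq (seq (V * nat) * nat)) :
  dp_wf mm -> all (fun p => dp_wf p.1) mm ->
  (0 < sumn (dp_exps (mu_monomial mm)))%N.
Proof.
rewrite /mu_monomial; case: mm => [//|[[//|x m] r] mm] /andP[_ /andP[/= r0 _]].
by move=> /andP[/andP[_ /andP[/= x0 _]] _]; rewrite addn_gt0 muln_gt0 r0 x0.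
Qed.

Lemma gamma_lift_dpm2 V (mm : seq (seq (V * nat) * nat)) :
  dp_wf mm -> all (fun p => dp_wf p.1) mm ->
  gamma_lift gamma_eval (dpm2 mm) =
  gamma_eval ((mu_coef mm)%:R *: dpm (mu_monomial mm)).
Proof.
move=> w w'; rewrite [RHS]linearZ /dpm2 gamma_lift_dpm; last first.
  by rewrite /dp_exps -map_comp; exact: dp_wf_sumn.
rewrite gamma_eval_dpm ?mu_monomial_sumn //.
rewrite [RHS]scaler_nat -dpow_mu_monomial // big_map big_seq [RHS]big_seq.
apply: eq_bigr => p pmm; congr dpow; rewrite gamma_eval_dpm //.
exact/dp_wf_sumn/(allP w').
Qed.

Lemma gamma_muE (mu : forall V, {linear gamma (gamma V) -> gamma V}) :
  is_gamma_mu mu -> forall V x, gamma_eval (mu V x) = gamma_lift gamma_eval x.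
Proof.
move=> muP V; apply: (gamma2_lin_ext (f := gamma_eval \o mu V)) => mm w w'.
by rewrite gamma_lift_dpm2 // -muP.
Qed.

Lemma gamma_mu_exists :
  exists mu : forall V, {linear gamma (gamma V) -> gamma V}, is_gamma_mu mu.
Proof.
have ex V : exists mu : {linear gamma (gamma V) -> gamma V},
    forall x, gamma_eval (mu x) = gamma_lift gamma_eval x.
  apply: gamma_factor (@gamma_span_dpm2 V) _ => _ [mm [w w' ->]].
  by exists ((mu_coef mm)%:R *: dpm (mu_monomial mm)); rewrite gamma_lift_dpm2.
exists (fun V => sval (cid (ex V))) => V mm w w'; case: cid => mu /= muE.
by apply: gamma_eval_inj; rewrite muE gamma_lift_dpm2.
Qed.

(** The transpose of [f]. *)
Definition dual_comp V W (f : {linear V -> W}) (psi : dual W) : dual V :=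
  vec_comp (psi : {linear W -> F^o}) f.

Lemma dual_compE V W (f : {linear V -> W}) psi v : dual_comp f psi v = psi (f v).
Proof. by []. Qed.

Lemma shuffle_map_point V W (f : {linear V -> W}) v :
  shuffle_map (dual_comp f) (point v) = point (f v).
Proof. by apply: funext => -[|? [|? ?]]. Qed.

Lemma gamma_eval_gmap V W (f : {linear V -> W}) x :
  gamma_eval (gmap f x) = shuffle_map (dual_comp f) (gamma_eval x).
Proof.
move: x; apply: (gamma_lin_ext (f := gamma_eval \o gmap f)
  (g := shuffle_map (dual_comp f) \o gamma_eval)) => m mw.
rewrite [LHS]/= gmap_dpm gamma_eval_dpm; last first.
  by rewrite /dp_exps -map_comp; exact: dp_wf_sumn.
rewrite [RHS]/= gamma_eval_dpm ?dp_wf_sumn // rmorph_prod big_map /=.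
by apply: eq_bigr => p _; rewrite shuffle_map_dpow shuffle_map_point.
Qed.

(** Leibniz's rule with D(z^[r]) = h(z)^[r-1] D(z), where h is the change of letters; a factor
    omitted from the monomial is a 0-th divided power. The general [z] covers both [point], for the
    formula of d, and [gamma_eval], for the chain rule [dc.4]. *)
Lemma shuffle_diff_monomial V A B (al be : B -> A) (z : V -> shuffle F A)
    (z' : V * V -> shuffle F B) (m : seq (V * nat)) :
  (forall v, z' (v, 0) = shuffle_map al (z v)) ->
  (forall v, z' (0, v) = shuffle_diff al be (z v)) -> dp_wf m ->
  shuffle_diff al be (\prod_(p <- m) dpow (z p.1) p.2) =
  \sum_(i < size m) \prod_(p <- diff_monomial m i) dpow (z' p.1) p.2.
Proof.
move=> z'0 z'1 /andP[_ /allP m0].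
rewrite (shuffle_diff_prod _ _ _ _ (0 : V, 0%N)); apply: eq_bigr => i _.
rewrite /diff_monomial; have : nth (0, 0%N) m i \in m by apply: mem_nth.
case: (nth _ m i) => v [/m0 //|r] _ /=.
have hE s : \prod_(p <- [seq ((p.1, 0), p.2) | p <- s]) dpow (z' p.1) p.2 =
    shuffle_map al (\prod_(p <- s) dpow (z p.1) p.2).
  rewrite big_map rmorph_prod /=; apply: eq_bigr => p _.
  by rewrite z'0 shuffle_map_dpow.
have rE : \prod_(p <- if r == 0 then [::] else [:: ((v, 0), r)]) dpow (z' p.1) p.2 =
    dpow (shuffle_map al (z v)) r.
  by case: r => [|r]; rewrite ?big_nil // big_seq1 z'0.
rewrite !big_cat !hE eqSS rE big_seq1 /= z'1 dpow1 // shuffle_diff_dpow; ring.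
Qed.

Lemma diff_monomial_sumn V (m : seq (V * nat)) i :
  (0 < sumn (dp_exps (diff_monomial m i)))%N.
Proof.
rewrite /diff_monomial /dp_exps; case: (nth _ m i) => v r.
by rewrite !catA map_cat sumn_cat /= addn1.
Qed.

Definition gamma_diff_eval V : shuffle F (dual V) -> shuffle F (dual (V * V)%type) :=
  shuffle_diff (dual_comp (vec_iota0 V V)) (dual_comp (vec_iota1 V V)).
HB.instance Definition _ V := GRing.Linear.on (@gamma_diff_eval V).

Lemma gamma_diff_eval_point V (v : V) : gamma_diff_eval (point v) = point (0 : V, v).
Proof.
apply: shuffle_ext => // psi; rewrite /gamma_diff_eval shuffle_deriv_diff.
rewrite !deriv_point !linearZ /= rmorph1 shuffle_diff1 scaler0 addr0.
by [].
Qed.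

Lemma gamma_diff_eval_dpm V (m : seq (V * nat)) : dp_wf m ->
  gamma_diff_eval (gamma_eval (dpm m)) =
  gamma_eval (\sum_(i < size m) dpm (diff_monomial m i)).
Proof.
move=> mw; rewrite gamma_eval_dpm ?dp_wf_sumn // linear_sum /=.
rewrite /gamma_diff_eval (shuffle_diff_monomial (z' := point)) //.
- by apply: eq_bigr => i _; rewrite gamma_eval_dpm // diff_monomial_sumn.
- by move=> v; rewrite shuffle_map_point.
- by move=> v; exact/esym/gamma_diff_eval_point.
Qed.

Lemma gamma_diffE (d : forall V, {linear gamma V -> gamma (V * V)%type}) :
  is_gamma_diff d -> forall V x, gamma_eval (d V x) = gamma_diff_eval (gamma_eval x).
Proof.
move=> dP V; apply: (gamma_lin_ext (f := gamma_eval \o d V)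
  (g := @gamma_diff_eval V \o gamma_eval)) => m mw.
by rewrite [RHS]gamma_diff_eval_dpm // -dP.
Qed.

Lemma gamma_diff_exists :
  exists d : forall V, {linear gamma V -> gamma (V * V)%type}, is_gamma_diff d.
Proof.
have ex V : exists d : {linear gamma V -> gamma (V * V)%type},
    forall x, gamma_eval (d x) = gamma_diff_eval (gamma_eval x).
  apply: (gamma_factor (L := @gamma_diff_eval V \o gamma_eval)) (@gamma_span_dpm V) _.
  move=> _ [m mw ->]; exists (\sum_(i < size m) dpm (diff_monomial m i)).
  by rewrite -gamma_diff_eval_dpm.
exists (fun V => sval (cid (ex V))) => V m mw; case: cid => d /= dE.
by apply: gamma_eval_inj; rewrite dE gamma_diff_eval_dpm.
Qed.

Section Unit.
Variable V : lmodType F.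

Fact tensor1_multilinear : multilinear (fun y : {ffun 'I_1 -> V} => y ord0).
Proof. by move=> y i c u v; rewrite !ffunE (ord1 i) eqxx. Qed.

Definition gamma_eps_fun (x : gamma V) : V :=
  tlift (fun y : {ffun 'I_1 -> V} => y ord0) (gamma_fam x 0).
Fact gamma_eps_linear : linear gamma_eps_fun.
Proof. by move=> c x y; exact: (tlift_linear tensor1_multilinear). Qed.
Definition gamma_eps : {linear gamma V -> V} := mklin gamma_eps_linear.

Lemma dual_gamma_eps (phi : dual V) x : phi (gamma_eps x) = gamma_eval x [:: phi].
Proof.
rewrite (@gamma_evalE _ _ x 0) // -[gamma_eps x]/(tlift _ _).
pose L := mklin (tlift_linear tensor1_multilinear).
pose L' := mklin (tlift_linear (@gamma_word_multilinear F V _ point 1)).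
have L'lin : linear (fun t => L' t [:: phi] : F^o).
  by move=> c s t; rewrite linearP shuffle_addE.
apply: (tens_ext (f := (phi : {linear V -> F^o}) \o L) (g := mklin L'lin)) => y.
rewrite [LHS](congr1 phi (tliftE tensor1_multilinear y)).
rewrite [RHS](_ : _ = tlift (@gamma_word F V _ point 1) (tens y) [:: phi]) //.
rewrite (tliftE (@gamma_word_multilinear F V _ point 1)) /gamma_word.
by rewrite enum_ordSl enum_ord0 /= half_prod_point_cons mulr1.
Qed.
End Unit.

Lemma gamma_epsP : is_gamma_eps gamma_eps.
Proof.
move=> V m mw; have [[v Em]|nm] := pselect (exists v, m = [:: (v, 1%N)]).
  rewrite Em; apply/eqP; rewrite -subr_eq0; apply: contraT => /separating_functional[phi].
  rewrite linearB dual_gamma_eps gamma_eval_dpm // big_seq1 dpow1 //.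
  by rewrite subrr => /esym/eqP; rewrite oner_eq0.
have -> : (if m is [:: (v, 1%N)] then v else 0) = 0.
  by case: m nm {mw} => [//|[v [|[|r]]] [|? ?]] // nm; case: nm; exists v.
rewrite -[LHS]/(tlift _ (dp_comp m 1)) /dp_comp ifN.
  exact: (linear0 (mklin (tlift_linear (@tensor1_multilinear V)))).
(* With positive exponents, degree 1 forces a single factor of exponent 1. *)
apply: contra_notN nm => /eqP; case: m mw => [//|[v r] [|[u q] m]] /= /andP[_].
  by rewrite addn0 => _ <-; exists v.
case/and3P => r0 q0 _; case: r q r0 q0 => [//|r] [//|q] _ _.
by rewrite !addnS.
Qed.

Lemma gamma_epsE (eps : forall V, {linear gamma V -> V}) : is_gamma_eps eps ->
  forall V (phi : dual V) x, phi (eps V x) = gamma_eval x [:: phi].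
Proof.
move=> epsP V phi x; rewrite -dual_gamma_eps; congr (phi _).
by apply: gamma_lin_ext x => m mw; rewrite epsP // gamma_epsP.
Qed.
End GammaOperations.

(** * Iterated differentials of functions of words *)

Section DiffComposition.
Variable F : comNzRingType.
Local Notation "''d_' a" := (shuffle_deriv a) (at level 8, a at level 2).

Lemma shuffle_map_diff A B C (al be : B -> A) (ga : C -> B) (z : shuffle F A) :
  shuffle_map ga (shuffle_diff al be z) = shuffle_diff (al \o ga) (be \o ga) z.
Proof.
apply: funext => l; elim: l z => // c l IH z.
rewrite -[LHS]/('d_c (shuffle_map ga (shuffle_diff al be z)) l).
rewrite -[RHS]/('d_c (shuffle_diff _ _ z) l) shuffle_deriv_map !shuffle_deriv_diff.
by rewrite linearD /= shuffle_map_comp !shuffle_addE IH.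
Qed.

Lemma shuffle_diff_map A B C (al : B -> A) (ga de : C -> B) (z : shuffle F A) :
  shuffle_diff ga de (shuffle_map al z) = shuffle_diff (al \o ga) (al \o de) z.
Proof.
apply: funext => l; elim: l z => // c l IH z.
rewrite -[LHS]/('d_c (shuffle_diff _ _ _) l) -[RHS]/('d_c (shuffle_diff _ _ z) l).
rewrite !shuffle_deriv_diff !shuffle_deriv_map shuffle_map_comp.
by rewrite !shuffle_addE IH.
Qed.

(** Each differential marks one letter. The four terms are the cases where the first letter carries
    both marks, only the outer one, only the inner one, or none. *)
Lemma shuffle_deriv_diff2 A B C (al be : B -> A) (a b : C -> B) (z : shuffle F A) c :
  'd_c (shuffle_diff a b (shuffle_diff al be z)) =
  shuffle_map (al \o a) ('d_(be (b c)) z)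
  + shuffle_diff (al \o a) (be \o a) ('d_(al (b c)) z)
  + shuffle_diff (al \o a) (al \o b) ('d_(be (a c)) z)
  + shuffle_diff a b (shuffle_diff al be ('d_(al (a c)) z)).
Proof.
rewrite shuffle_deriv_diff !shuffle_deriv_diff !linearD /= shuffle_map_comp.
by rewrite shuffle_map_diff shuffle_diff_map !addrA.
Qed.

(** The hypotheses say that priming exchanges the two marks, so the second and third terms of
    [shuffle_deriv_diff2] change places. This gives [dc.6]. *)
Lemma shuffle_diff2_swap A B C (al be : B -> A) (a b a' b' : C -> B) (z : shuffle F A) :
  al \o a = al \o a' -> be \o b = be \o b' -> al \o b = be \o a' -> be \o a = al \o b' ->
  shuffle_diff a b (shuffle_diff al be z) = shuffle_diff a' b' (shuffle_diff al be z).
Proof.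
move=> aa bb ab ba; apply: funext => l; elim: l z => // c l IH z.
rewrite -[LHS]/('d_c (shuffle_diff _ _ _) l) -[RHS]/('d_c (shuffle_diff _ _ _) l).
rewrite !shuffle_deriv_diff2 -aa -ab -ba.
have E (f g : C -> A) : f = g -> f c = g c by move=> ->.
rewrite -[be (b c)]/((be \o b) c) -[be (b' c)]/((be \o b') c) -bb.
rewrite -[al (b' c)]/((al \o b') c) -ba -[be (a' c)]/((be \o a') c) -ab.
rewrite -[al (a' c)]/((al \o a') c) -aa !shuffle_addE IH /=; ring.
Qed.
End DiffComposition.

(** * Functions of words that are additive in every letter *)

Section SlotAdditive.
Variables (F : fieldType) (V : lmodType F).
Local Notation "''d_' a" := (shuffle_deriv a) (at level 8, a at level 2).
Implicit Types (z : shuffle F (dual V)) (phi chi psi : dual V).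

(** The property of the functions [gamma_eval x] from which [dc.1], [dc.2], [dc.5] and [du.2] are
    derived. The sum of functionals is expressed by its values. *)
Definition slot_additive z : Prop := forall s t (phi chi psi : dual V),
  (forall v, psi v = phi v + chi v) ->
  z (s ++ psi :: t) = z (s ++ phi :: t) + z (s ++ chi :: t).

Lemma slot_additive_deriv z phi : slot_additive z -> slot_additive ('d_phi z).
Proof. by move=> zA s; exact: zA (phi :: s). Qed.

Lemma slot_additive_derivD z phi chi psi : slot_additive z ->
  (forall v, psi v = phi v + chi v) -> 'd_psi z = 'd_phi z + 'd_chi z.
Proof. by move=> zA E; apply: funext => t; exact: (zA [::]). Qed.

Lemma slot_additive_deriv0 z phi : slot_additive z ->
  (forall v, phi v = 0) -> 'd_phi z = 0.
Proof.
move=> zA p0; have E v : phi v = phi v + phi v by rewrite !p0 addr0.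
have /eqP := slot_additive_derivD zA E.
by rewrite -subr_eq0 opprD addNKr oppr_eq0 => /eqP.
Qed.

Lemma slot_additiveM z z' : slot_additive z -> slot_additive z' -> slot_additive (z * z').
Proof.
move=> zA zA' s; elim: s z z' zA zA' => [|a s IH] z z' zA zA' t phi chi psi E /=.
  rewrite -![(z * z') (_ :: t)]/('d__ (z * z') t) !shuffle_derivM.
  rewrite (slot_additive_derivD zA E) (slot_additive_derivD zA' E).
  by rewrite !shuffle_addE mulrDl mulrDr !shuffle_addE addrACA.
rewrite -![(z * z') (_ :: _)]/('d__ (z * z') _) !shuffle_derivM !shuffle_addE.
by rewrite !(IH _ _ _ _ t phi chi psi) //; [exact: addrACA|exact: slot_additive_deriv..].
Qed.

Lemma slot_additive1 : slot_additive 1.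
Proof. by move=> [|a s] t phi chi psi _; rewrite !shuffle_1E addr0. Qed.

Lemma slot_additive_dpow_point v n : slot_additive (dpow (point v) n).
Proof.
elim: n => [|n IH]; first exact: slot_additive1.
have dE a l : dpow (point v) n.+1 (a :: l) = a v * dpow (point v) n l.
  rewrite -[LHS]/('d_a (dpow (point v) n.+1) l) deriv_dpow deriv_point -scalerAl.
  by rewrite mul1r.
move=> [|a s] t phi chi psi E /=; rewrite !dE; first by rewrite E mulrDl.
by rewrite (IH s t phi chi psi) // mulrDr.
Qed.

Lemma slot_additive_gamma_eval (x : gamma V) : slot_additive (gamma_eval x).
Proof.
move=> s t phi chi psi E; elim: (gamma_span_dpm x) => [|c _ y [m mw ->] _ IH].
  by rewrite linear0 !shuffle_0E addr0.
rewrite linearP !shuffle_addE !shuffle_scaleE IH.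
have dA : slot_additive (gamma_eval (dpm m)).
  rewrite gamma_eval_dpm ?dp_wf_sumn //; elim/big_rec: _ => [|p z _ zA].
    exact: slot_additive1.
  by apply: slot_additiveM => //; exact: slot_additive_dpow_point.
by rewrite (dA s t phi chi psi) // mulrDr addrACA.
Qed.

Section Diff.
Variable B : Type.
Implicit Types al be : B -> dual V.

Lemma shuffle_diffDr al be be1 be2 z : slot_additive z ->
  (forall b v, be b v = be1 b v + be2 b v) ->
  shuffle_diff al be z = shuffle_diff al be1 z + shuffle_diff al be2 z.
Proof.
move=> zA E; apply: funext => l; elim: l z zA => [|b l IH] z zA.
  by rewrite shuffle_addE addr0.
rewrite -[LHS]/('d_b (shuffle_diff _ _ _) l) -[RHS]/('d_b (_ + _) l).
rewrite linearD /= !shuffle_deriv_diff (slot_additive_derivD zA (E b)) linearD /=.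
rewrite !shuffle_addE IH; last exact: slot_additive_deriv.
by rewrite !shuffle_addE; ring.
Qed.

Lemma shuffle_diff0r al be z : slot_additive z ->
  (forall b v, be b v = 0) -> shuffle_diff al be z = 0.
Proof.
move=> zA E; have E2 b v : be b v = be b v + be b v by rewrite !E addr0.
have /eqP := shuffle_diffDr al zA E2.
by rewrite -subr_eq0 opprD addNKr oppr_eq0 => /eqP.
Qed.

(** Every unmarked letter becomes zero, so only words consisting of the marked letter alone
    survive. *)
Lemma shuffle_diff0l al be z l : slot_additive z -> (forall b v, al b v = 0) ->
  shuffle_diff al be z l = if l is [:: b] then z [:: be b] else 0.
Proof.
move=> zA E; case: l => // b l.
rewrite -[LHS]/('d_b (shuffle_diff _ _ _) l) shuffle_deriv_diff.
rewrite (slot_additive_deriv0 zA (E b)) linear0 addr0.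
case: l => // b' l; rewrite -[LHS]/('d_(al b') ('d_(be b) z) (map al l)).
rewrite (slot_additive_deriv0 _ (E b')) //; exact: slot_additive_deriv.
Qed.

(** A letter with exactly one mark becomes zero, so both marks must fall on the same letter. *)
Lemma shuffle_diff2_diag C (al be : B -> dual V) (a b : C -> B) z : slot_additive z ->
  (forall c v, al (b c) v = 0) -> (forall c v, be (a c) v = 0) ->
  shuffle_diff a b (shuffle_diff al be z) = shuffle_diff (al \o a) (be \o b) z.
Proof.
move=> zA ab0 ba0; apply: funext => l; elim: l z zA => // c l IH z zA.
rewrite -[LHS]/('d_c (shuffle_diff _ _ _) l) -[RHS]/('d_c (shuffle_diff _ _ _) l).
rewrite shuffle_deriv_diff2 shuffle_deriv_diff (slot_additive_deriv0 zA (ab0 c)).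
rewrite (slot_additive_deriv0 zA (ba0 c)) !linear0 !addr0 !shuffle_addE IH //.
exact: slot_additive_deriv.
Qed.
End Diff.
End SlotAdditive.

(** * From differential comonads to Cartesian differential categories *)

Lemma functor_eq (Y Z : category) (o : Y -> Z)
    (m m' : forall A B : Y, hom A B -> hom (o A) (o B)) p q p' q' :
  (forall (A B : Y) (f : hom A B), m A B f = m' A B f) ->
  @Functor Y Z o m p q = @Functor Y Z o m' p' q'.
Proof.
move=> mm'; have E : m = m'.
  apply: functional_extensionality_dep => A.
  by apply: functional_extensionality_dep => B; apply: funext => f.
case: _ / E p' q' => p' q'.
by rewrite (Prop_irrelevance p p') (Prop_irrelevance q q').
Qed.

Section BiproductTheory.
Local Open Scope cat_scope.
Variable X : biprod_category.
Implicit Types A B C D : X.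

Lemma badd0r A B : right_id (bzero A B) (@badd X A B).
Proof. by move=> f; rewrite baddC badd0. Qed.

Lemma bcopair_comp A B C D (k : hom C D) (f : hom A C) (g : hom B C) :
  k \oc bcopair f g = bcopair (k \oc f) (k \oc g).
Proof. by rewrite /bcopair bcompDr !compmA. Qed.

Lemma bcopair_iota0 A B C (f : hom A C) (g : hom B C) : bcopair f g \oc biota0 A B = f.
Proof.
by rewrite /bcopair bcompDl -!compmA bpi0_iota0 bpi1_iota0 compm1 bcomp0r badd0r.
Qed.
Lemma bcopair_iota1 A B C (f : hom A C) (g : hom B C) : bcopair f g \oc biota1 A B = g.
Proof.
by rewrite /bcopair bcompDl -!compmA bpi0_iota1 bpi1_iota1 compm1 bcomp0r badd0.
Qed.
Lemma bpi0_pair A B C (f : hom C A) (g : hom C B) : bpi0 A B \oc bpair f g = f.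
Proof.
by rewrite /bpair bcompDr !compmA bpi0_iota0 bpi0_iota1 comp1m bcomp0l badd0r.
Qed.
Lemma bpi1_pair A B C (f : hom C A) (g : hom C B) : bpi1 A B \oc bpair f g = g.
Proof.
by rewrite /bpair bcompDr !compmA bpi1_iota0 bpi1_iota1 comp1m bcomp0l badd0.
Qed.
Lemma bpair_ext A B C (f g : hom C (bprod A B)) :
  bpi0 A B \oc f = bpi0 A B \oc g -> bpi1 A B \oc f = bpi1 A B \oc g -> f = g.
Proof.
by move=> f0 f1; rewrite -[f]comp1m -[g]comp1m -biota_pi !bcompDl -!compmA f0 f1.
Qed.
Lemma bcopair_ext A B C (f g : hom (bprod A B) C) :
  f \oc biota0 A B = g \oc biota0 A B -> f \oc biota1 A B = g \oc biota1 A B -> f = g.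
Proof.
by move=> f0 f1; rewrite -[f]compm1 -[g]compm1 -biota_pi !bcompDr !compmA f0 f1.
Qed.

Lemma bmap_iota0 A B C D (f : hom A C) (g : hom B D) :
  bmap f g \oc biota0 A B = biota0 C D \oc f.
Proof.
rewrite /bmap /bpair bcompDl -!compmA bpi0_iota0 bpi1_iota0 compm1.
by rewrite !bcomp0r badd0r.
Qed.
Lemma bmap_iota1 A B C D (f : hom A C) (g : hom B D) :
  bmap f g \oc biota1 A B = biota1 C D \oc g.
Proof.
rewrite /bmap /bpair bcompDl -!compmA bpi0_iota1 bpi1_iota1 compm1.
by rewrite !bcomp0r badd0.
Qed.

(** In the opposite category pairings become copairings; the interchange map is its own dual. *)
Lemma bswap_copair A :
  bcopair (bmap (biota0 A A) (biota0 A A)) (bmap (biota1 A A) (biota1 A A)) = bswap A.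
Proof.
rewrite /bswap; apply: bcopair_ext; rewrite ?bcopair_iota0 ?bcopair_iota1;
  apply: bpair_ext; rewrite !compmA ?bpi0_pair ?bpi1_pair ?bmap_iota0 ?bmap_iota1;
  by rewrite /bmap ?bpi0_pair ?bpi1_pair.
Qed.
End BiproductTheory.

Section KleisliDifferential.
Local Open Scope cat_scope.
Variables (X : biprod_category) (S : monad X).
Variable d : forall V : X, hom (S V) (S (bprod V V)).
Hypothesis dP : is_differential_comonad d.
Local Notation mu := (mmult S).
Local Notation eta := (munit S).
Local Notation K := (op_kleisli S).
Local Notation D := (@op_kleisli_diff X S d).
Implicit Types A B C : X.

(** The structural maps of the Kleisli category have the form eta after k. Composition with them
    reduces to [fmap S k], which turns the axioms of a differential category into those of the
    comonad. *)
Lemma kl_comp_etar A B C (g : kl_hom S B C) (k : hom B A) :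
  kl_comp g (eta A \oc k) = fmap S k \oc g.
Proof.
by rewrite /kl_comp fmapM compmA (mu_etar (monadP S)) comp1m.
Qed.

Lemma lmap_eta A B C C' (f : hom C A) (g : hom C' B) :
  @lmap K A B C C' (eta A \oc f) (eta B \oc g) = eta (bprod A B) \oc bmap f g :> kl_hom S _ _.
Proof.
rewrite -[LHS]/(bcopair (kl_comp (eta A \oc f) (kl_pi0 S A B))
                        (kl_comp (eta B \oc g) (kl_pi1 S A B))).
rewrite !kl_comp_eta /kl_pi0 /kl_pi1; apply: bcopair_ext.
  by rewrite bcopair_iota0 -!compmA bmap_iota0.
by rewrite bcopair_iota1 -!compmA bmap_iota1.
Qed.

Lemma liota0_eta A B : @liota0 K A B = eta A \oc bpi0 A B.
Proof. by rewrite -[LHS]/(bcopair (eta A) (bzero _ _)) /bcopair bcomp0l badd0r. Qed.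
Lemma liota1_eta A B : @liota1 K A B = eta B \oc bpi1 A B.
Proof. by rewrite -[LHS]/(bcopair (bzero _ _) (eta B)) /bcopair bcomp0l badd0. Qed.

(** [CD.1] and [CD.4] hold because composition with d is additive; [CD.2] comes from [dc.1] and
    [dc.2], [CD.3] from [dc.3], [CD.5] from [dc.4] and naturality, [CD.6] from [dc.5], [CD.7] from
    [dc.6]. *)
Lemma op_kleisli_differential : is_cartesian_differential D.
Proof.
have dE A B (f : kl_hom S A B) : @op_kleisli_diff X S d A B f = d A \oc f by [].
have idE A : idm (A : K) = eta A \oc idm (A : X) by rewrite compm1.
have nablaE A : @lnabla K A = eta (bprod A A) \oc bdiag A.
  by rewrite /bdiag /bpair !compm1 bcompDr.
split.
- by move=> A B f g; exact: bcompDr.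
- by move=> A B; exact: bcomp0r.
- move=> A B f; rewrite nablaE idE !lmap_eta.
  rewrite -[LHS]/(kl_comp (d A \oc f) _) kl_comp_etar compmA (dc2 dP).
  rewrite -[RHS]/(badd (kl_comp (d A \oc f) _) (kl_comp (d A \oc f) _)).
  by rewrite !kl_comp_etar !compmA -!bcompDl.
- move=> A B f; rewrite liota0_eta -[LHS]/(kl_comp (d A \oc f) _) kl_comp_etar.
  by rewrite compmA (dc1 dP) bcomp0l.
- by move=> A; exact: (dc3 dP).
- move=> A B; rewrite -[LHS]/(d _ \oc (eta _ \oc biota0 A B)) compmA (dc3 dP).
  by rewrite -[RHS]/(kl_comp (eta _ \oc _) _) kl_comp_eta.
- move=> A B; rewrite -[LHS]/(d _ \oc (eta _ \oc biota1 A B)) compmA (dc3 dP).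
  by rewrite -[RHS]/(kl_comp (eta _ \oc _) _) kl_comp_eta.
- by move=> A B C f g; exact: bcopair_comp.
- move=> A B C g f; rewrite -[LHS]/(d A \oc (mu A \oc fmap S f \oc g)).
  rewrite -[RHS]/(mu _ \oc fmap S (bcopair (kl_comp f (kl_pi0 S A A)) (d A \oc f)) \oc (d B \oc g)).
  rewrite /kl_pi0 kl_comp_etar !compmA (dc4 dP).
  (* Naturality moves f across d, so that both sides apply S to maps out of a biproduct, which are
     compared on the injections. *)
  rewrite -(compmA _ (d (S A))) (dc_nat dP) !compmA -(compmA (mu _)) -fmapM.
  congr (mu _ \oc fmap S _ \oc _ \oc _); apply: bcopair_ext.
    by rewrite -compmA bmap_iota0 compmA !bcopair_iota0.
  by rewrite -compmA bmap_iota1 compmA !bcopair_iota1.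
- move=> A B f; rewrite /lell liota0_eta liota1_eta lmap_eta.
  rewrite -[LHS]/(kl_comp (d _ \oc (d A \oc f)) _) kl_comp_etar.
  by rewrite !compmA (dc5 dP).
- move=> A B f; have -> : @lswap K A = eta _ \oc bswap A.
    rewrite /lswap -[lpi0 _ _]/(eta _ \oc biota0 A A) -[lpi1 _ _]/(eta _ \oc biota1 A A).
    by rewrite !lmap_eta -[LHS]/(bcopair _ _) -bcopair_comp bswap_copair.
  rewrite -[LHS]/(kl_comp (d _ \oc (d A \oc f)) _) kl_comp_etar.
  by rewrite -[RHS]/(d _ \oc (d A \oc f)) !compmA (dc6 dP).
Qed.

Variable eps : forall V : X, hom (S V) V.
Hypothesis epsP : is_Dlinear_unit d eps.
Variable cdP : is_cartesian_differential D.
Local Notation CK := (CartesianDifferential cdP).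

Let lin_unit A B (k : hom B A) : @Dlinear CK A B (eta A \oc k).
Proof.
rewrite /Dlinear -[LHS]/(d A \oc (eta A \oc k)) -[RHS]/(kl_comp (eta A \oc k) (kl_pi1 S A A)).
by rewrite compmA (dc3 dP) kl_comp_eta.
Qed.

(** D-linearity says that d f = S(iota_1) f; applying S(pi_1) and [du.2] gives eta eps f = f. *)
Let lin_unitK A B (f : @Dlin_hom CK A B) : eta A \oc (eps A \oc sval f) = sval f.
Proof.
case: f => f /=; rewrite /Dlinear -[LHS]/(d A \oc f) -[RHS]/(kl_comp f (kl_pi1 S A A)).
rewrite /kl_pi1 kl_comp_etar => df.
by rewrite compmA (du2 epsP) -compmA df compmA -fmapM bpi1_iota1 fmap1 comp1m.
Qed.

Let unit_linK A B (k : hom B A) : eps A \oc (eta A \oc k) = k.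
Proof. by rewrite compmA (du1 epsP) comp1m. Qed.

Lemma Dlin_op_kleisli : cat_isomorphic (Dlin CK) (cat_op X).
Proof.
pose Gm (A B : Dlin CK) (f : hom A B) : @hom (cat_op X) A B := eps A \oc sval f.
pose Hm (A B : cat_op X) (k : hom A B) : @hom (Dlin CK) A B :=
  exist _ (eta A \oc k) (lin_unit k).
have G1 A : Gm A A (@idm (Dlin CK) A) = @idm (cat_op X) A by exact: du1 epsP A.
have GM A B C (g : @hom (Dlin CK) B C) (f : @hom (Dlin CK) A B) :
    Gm A C (@compm (Dlin CK) A B C g f) = @compm (cat_op X) A B C (Gm B C g) (Gm A B f).
  rewrite /Gm -[LHS]/(eps A \oc kl_comp (sval g) (sval f)) -[in LHS](lin_unitK g).
  by rewrite kl_comp_eta compmA.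
have H1 A : Hm A A (@idm (cat_op X) A) = @idm (Dlin CK) A.
  by apply: Dlin_ext; rewrite /= compm1.
have HM A B C (g : @hom (cat_op X) B C) (f : @hom (cat_op X) A B) :
    Hm A C (@compm (cat_op X) A B C g f) = @compm (Dlin CK) A B C (Hm B C g) (Hm A B f).
  apply: Dlin_ext; rewrite /= -[RHS]/(kl_comp (eta B \oc g) (eta A \oc f)).
  by rewrite kl_comp_eta compmA.
pose G := @Functor (Dlin CK) (cat_op X) (fun A => A) Gm G1 GM.
pose H := @Functor (cat_op X) (Dlin CK) (fun A => A) Hm H1 HM.
exists G, H; split; apply: functor_eq => A B f.
  by apply: Dlin_ext; exact: lin_unitK.
exact: unit_linK.
Qed.
End KleisliDifferential.

(** * The divided power monad *)

Section GammaMonad.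
Variables (F : fieldType).
Implicit Types V W : lmodType F.
Variable mu : forall V, {linear gamma (gamma V) -> gamma V}.
Hypothesis muP : is_gamma_mu mu.

Lemma gamma_eval_eta V (v : V) : gamma_eval (gamma_eta V v) = point v.
Proof. by rewrite -[gamma_eta V v]/(dpm _) gamma_eval_dpm // big_seq1 dpow1. Qed.

Lemma gamma_lift_gmap V W A (g : {linear W -> shuffle F A}) (f : {linear V -> W}) x :
  gamma_lift g (gmap f x) = gamma_lift (g \o f) x.
Proof.
move: x; apply: (gamma_lin_ext (f := gamma_lift g \o gmap f)) => m mw.
rewrite [LHS]/= gmap_dpm gamma_lift_dpm; last first.
  by rewrite /dp_exps -map_comp; exact: dp_wf_sumn.
by rewrite gamma_lift_dpm ?dp_wf_sumn // big_map.
Qed.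

Lemma shuffle_map_gamma_lift V A B (al : B -> A) (g : {linear V -> shuffle F A}) x :
  shuffle_map al (gamma_lift g x) = gamma_lift (shuffle_map al \o g) x.
Proof.
move: x; apply: (gamma_lin_ext (f := shuffle_map al \o gamma_lift g)) => m mw.
rewrite [LHS]/= !gamma_lift_dpm ?dp_wf_sumn // rmorph_prod.
by apply: eq_bigr => p _; exact: shuffle_map_dpow.
Qed.

Lemma gamma_lift_eta V A (g : {linear V -> shuffle F A}) v :
  g v [::] = 0 -> gamma_lift g (gamma_eta V v) = g v.
Proof.
by move=> gv0; rewrite -[gamma_eta V v]/(dpm _) gamma_lift_dpm // big_seq1 dpow1.
Qed.

Lemma gamma_eval_nil V (x : gamma V) : gamma_eval x [::] = 0.
Proof. by rewrite gamma_liftE big_ord0. Qed.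

Lemma eq_gamma_lift V A (g g' : {linear V -> shuffle F A}) :
  g =1 g' -> gamma_lift g =1 gamma_lift g'.
Proof. by move=> /lin_ext ->. Qed.

(** Like [gamma_muE], but for any g: both sides send monomials of monomials to products of divided
    powers of products. With g a lift itself this yields associativity of mu. *)
Lemma gamma_lift_mu V A (g : {linear V -> shuffle F A}) (x : gamma (gamma V)) :
  gamma_lift g (mu V x) = gamma_lift (gamma_lift g) x.
Proof.
move: x; apply: (gamma2_lin_ext (f := gamma_lift g \o mu V)) => mm w w'.
rewrite [LHS]/= (muP w w') [LHS]linearZ gamma_lift_dpm ?mu_monomial_sumn //.
rewrite [LHS]scaler_nat -dpow_mu_monomial // /dpm2 gamma_lift_dpm; last first.
  by rewrite /dp_exps -map_comp; exact: dp_wf_sumn.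
rewrite big_map big_seq [RHS]big_seq; apply: eq_bigr => p pmm; congr dpow.
by rewrite gamma_lift_dpm // dp_wf_sumn // (allP w').
Qed.

Lemma gamma_monad : @is_monad (vec F) (gamma_functor F) mu (@gamma_eta F).
Proof.
split=> [V W f|V W f|V|V|V]; apply: lin_ext => x; apply: gamma_eval_inj.
- rewrite -[LHS]/(gamma_eval (mu W (gmap (gamma_map f) x))).
  rewrite -[RHS]/(gamma_eval (gmap f (mu V x))).
  rewrite gamma_eval_gmap !gamma_muE // gamma_lift_gmap shuffle_map_gamma_lift.
  by apply: eq_gamma_lift => y /=; exact: gamma_eval_gmap.
- rewrite -[LHS]/(gamma_eval (gamma_eta W (f x))).
  rewrite -[RHS]/(gamma_eval (gmap f (gamma_eta V x))).
  by rewrite gamma_eval_gmap !gamma_eval_eta shuffle_map_point.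
- rewrite -[LHS]/(gamma_eval (mu V (gmap (mu V) x))).
  rewrite -[RHS]/(gamma_eval (mu V (mu (gamma V) x))).
  rewrite !(gamma_muE muP) gamma_lift_gmap gamma_lift_mu.
  by apply: eq_gamma_lift => y; exact: gamma_muE.
- rewrite -[LHS]/(gamma_eval (mu V (gamma_eta _ x))).
  by rewrite gamma_muE // gamma_lift_eta // gamma_eval_nil.
- rewrite -[LHS]/(gamma_eval (mu V (gmap (gamma_eta V) x))).
  rewrite gamma_muE // gamma_lift_gmap -[gamma_eval in RHS]/(gamma_lift point).
  by apply: eq_gamma_lift => v; exact: gamma_eval_eta.
Qed.
End GammaMonad.

Section VecBiproduct.
Variable F : fieldType.
Implicit Types U V W : lmodType F.

Lemma vec_bpairE U V W (f : {linear U -> V}) (g : {linear U -> W}) u :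
  (@bpair (vec F) U V W f g : {linear U -> (V * W)%type}) u = (f u, g u).
Proof. by rewrite -[LHS]/(f u + 0, 0 + g u) addr0 add0r. Qed.

Lemma vec_bmapE U U' V W (f : {linear U -> V}) (g : {linear U' -> W}) u :
  (@bmap (vec F) U U' V W f g : {linear (U * U')%type -> (V * W)%type}) u = (f u.1, g u.2).
Proof. exact: vec_bpairE. Qed.

Lemma vec_iota0E V W v : vec_iota0 V W v = (v, 0). Proof. by []. Qed.
Lemma vec_iota1E V W w : vec_iota1 V W w = (0, w). Proof. by []. Qed.

Lemma dual_comp2E U V W (f : {linear U -> V}) (g : {linear V -> W}) psi u :
  (dual_comp f \o dual_comp g) psi u = psi (g (f u)).
Proof. by []. Qed.

Lemma dual_comp3E U V V' W (f : {linear U -> V}) (g : {linear V -> V'})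
  (h : {linear V' -> W}) psi u :
  (dual_comp f \o (dual_comp g \o dual_comp h)) psi u = psi (h (g (f u))).
Proof. by []. Qed.

Lemma dual_ext V (phi psi : dual V) : (forall v, phi v = psi v) -> phi = psi.
Proof. exact: lin_ext. Qed.
End VecBiproduct.

Section GammaDifferential.
Variables (F : fieldType).
Implicit Types V W : lmodType F.
Variable mu : forall V, {linear gamma (gamma V) -> gamma V}.
Variable d : forall V, {linear gamma V -> gamma (V * V)%type}.
Hypothesis (muP : is_gamma_mu mu) (dP : is_gamma_diff d).
Let G : monad (vec F) := Monad (gamma_monad muP).

Lemma gamma_eval_gmap_diff V W (f : {linear (V * V)%type -> W}) x :
  gamma_eval (gmap f (d V x)) =
  shuffle_diff (dual_comp (vec_iota0 V V) \o dual_comp f)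
               (dual_comp (vec_iota1 V V) \o dual_comp f) (gamma_eval x).
Proof. by rewrite gamma_eval_gmap (gamma_diffE dP) /gamma_diff_eval shuffle_map_diff. Qed.

Lemma gamma_eval_diff2 V x : gamma_eval (d _ (d V x)) =
  gamma_diff_eval (gamma_diff_eval (gamma_eval x)).
Proof. by rewrite !(gamma_diffE dP). Qed.

Lemma gamma_differential : is_differential_comonad (X := vec F) (S := G) d.
Proof.
split=> [V W f|V|V|V|V|V|V]; apply: lin_ext => x; apply: gamma_eval_inj.
- rewrite -[LHS]/(gamma_eval (d W (gmap f x))).
  rewrite -[RHS]/(gamma_eval (gmap (bmap (X := vec F) f f) (d V x))).
  rewrite gamma_eval_gmap_diff (gamma_diffE dP) gamma_eval_gmap.
  rewrite /gamma_diff_eval shuffle_diff_map.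
  by congr shuffle_diff; apply: funext => psi; apply: dual_ext => v;
    rewrite !dual_comp2E vec_bmapE ?vec_iota0E ?vec_iota1E linear0.
- rewrite -[LHS]/(gamma_eval (gmap (vec_pi0 V V) (d V x))) [RHS]linear0.
  rewrite gamma_eval_gmap_diff; apply: shuffle_diff0r.
    exact: slot_additive_gamma_eval.
  by move=> psi v; rewrite dual_comp2E; exact: linear0.
- set f1 := bdiag V; rewrite -[LHS]/(gamma_eval (gmap (bmap (X := vec F) (idm _) f1) (d V x))).
  rewrite -[RHS]/(gamma_eval (gmap (bmap (X := vec F) (idm _) (vec_iota0 V V)) (d V x) +
     gmap (bmap (X := vec F) (idm _) (vec_iota1 V V)) (d V x))).
  rewrite linearD /= !gamma_eval_gmap_diff.
  set a0 := dual_comp (vec_iota0 V V).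
  (* On unmarked letters the second component is g 0 = 0 for every g, so the three differentials
     differ only in the marked letter, where additivity applies. *)
  have E (g h : {linear V -> (V * V)%type}) :
      a0 \o dual_comp (bmap (X := vec F) (idm (V : vec F)) g) =
      a0 \o dual_comp (bmap (X := vec F) (idm (V : vec F)) h).
    apply: funext => psi; apply: dual_ext => v.
    by rewrite !dual_comp2E !vec_bmapE vec_iota0E !linear0.
  rewrite (E (vec_iota0 V V) f1) (E (vec_iota1 V V) f1); apply: shuffle_diffDr.
    exact: slot_additive_gamma_eval.
  move=> psi v; rewrite !dual_comp2E !vec_bmapE vec_bpairE -linearD.
  by congr (psi _); rewrite -[RHS]/(_ + _, (_ + _, _ + _)) /= !addr0 add0r.
- rewrite -[LHS]/(gamma_eval (d V (gamma_eta V x))).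
  rewrite -[RHS]/(gamma_eval (gamma_eta _ (vec_iota1 V V x))).
  by rewrite (gamma_diffE dP) !gamma_eval_eta gamma_diff_eval_point.
- set g := bcopair (X := vec F) (fmap G (vec_iota0 V V)) (d V).
  rewrite -[LHS]/(gamma_eval (d V (mu V x))).
  rewrite -[RHS]/(gamma_eval (mu _ (gmap g (d _ x)))).
  rewrite (gamma_diffE dP) !(gamma_muE muP) gamma_lift_gmap.
  pose L := @gamma_diff_eval F V \o gamma_lift gamma_eval.
  (* Both sides are compared on monomials in arbitrary elements of Gamma(V), where they are the two
     sides of [shuffle_diff_monomial] for [gamma_eval]. *)
  move: x; apply: (gamma_lin_ext (f := L) (g := gamma_lift (gamma_eval \o g) \o d _)) => m mw.
  rewrite [LHS]/= [RHS]/= dP // linear_sum gamma_lift_dpm ?dp_wf_sumn //.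
  rewrite /gamma_diff_eval (shuffle_diff_monomial (z' := gamma_eval \o g)) //.
  + by apply: eq_bigr => i _; rewrite gamma_lift_dpm // diff_monomial_sumn.
  + move=> v; rewrite -[LHS]/(gamma_eval (gmap (vec_iota0 V V) v + d V 0)).
    by rewrite linear0 addr0 gamma_eval_gmap.
  + move=> v; rewrite -[LHS]/(gamma_eval (gmap (vec_iota0 V V) 0 + d V v)).
    by rewrite linear0 add0r (gamma_diffE dP).
- rewrite -[LHS]/(gamma_eval (gmap (bmap (X := vec F) (vec_pi0 V V) (vec_pi1 V V)) (d _ (d V x)))).
  rewrite gamma_eval_gmap gamma_eval_diff2 (gamma_diffE dP) /gamma_diff_eval shuffle_map_diff.
  rewrite shuffle_diff2_diag.
  + by congr shuffle_diff; apply: funext => psi; apply: dual_ext => v;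
      rewrite dual_comp3E vec_bmapE.
  + exact: slot_additive_gamma_eval.
  + by move=> psi v; rewrite dual_compE dual_comp2E vec_bmapE; exact: linear0.
  + by move=> psi v; rewrite dual_compE dual_comp2E vec_bmapE; exact: linear0.
- rewrite -[LHS]/(gamma_eval (gmap (bswap (X := vec F) V) (d _ (d V x)))).
  rewrite -[RHS]/(gamma_eval (d _ (d V x))).
  rewrite gamma_eval_gmap gamma_eval_diff2 /gamma_diff_eval shuffle_map_diff.
  by apply: shuffle_diff2_swap; apply: funext => psi; apply: dual_ext => v;
    rewrite !(dual_comp3E, dual_comp2E) /bswap vec_bpairE !vec_bmapE.
Qed.

Variable eps : forall V, {linear gamma V -> V}.
Hypothesis epsP : is_gamma_eps eps.

Lemma gamma_Dlinear_unit : is_Dlinear_unit (X := vec F) (S := G) d eps.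
Proof.
have sep V (u v : V) : (forall phi : dual V, phi u = phi v) -> u = v.
  move=> uv; apply/eqP; rewrite -subr_eq0; apply: contraT => /separating_functional[phi].
  by rewrite linearB uv subrr => /esym/eqP; rewrite oner_eq0.
split=> [V W f|V|V]; apply: lin_ext => x.
- apply: sep => phi; rewrite -[LHS]/(phi (eps W (gmap f x))) (gamma_epsE epsP) gamma_eval_gmap.
  by rewrite -[RHS]/(dual_comp f phi (eps V x)) (gamma_epsE epsP).
- exact: epsP.
- apply: gamma_eval_inj; rewrite -[LHS]/(gamma_eval (gamma_eta V (eps V x))).
  rewrite -[RHS]/(gamma_eval (gmap (vec_pi1 V V) (d V x))) gamma_eval_gmap_diff.
  rewrite gamma_eval_eta; apply: funext => l.
  rewrite shuffle_diff0l; last 2 first.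
  + exact: slot_additive_gamma_eval.
  + by move=> psi v; rewrite dual_comp2E; exact: linear0.
  case: l => [//|phi [|//]]; rewrite -[LHS]/(phi (eps V x)) (gamma_epsE epsP).
  by congr (gamma_eval x [:: _]); apply: dual_ext.
Qed.
End GammaDifferential.

Theorem corollary6p5 (F : fieldType) :
  (exists (mu : forall V : lmodType F, {linear gamma (gamma V) -> gamma V})
          (d : forall V : lmodType F, {linear gamma V -> gamma (V * V)%type})
          (eps : forall V : lmodType F, {linear gamma V -> V}),
      [/\ is_gamma_mu mu, is_gamma_diff d & is_gamma_eps eps])
  /\
  (forall (mu : forall V : lmodType F, {linear gamma (gamma V) -> gamma V})
          (d : forall V : lmodType F, {linear gamma V -> gamma (V * V)%type})
          (eps : forall V : lmodType F, {linear gamma V -> V}),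
      is_gamma_mu mu -> is_gamma_diff d -> is_gamma_eps eps ->
      exists monadG : @is_monad (vec F) (gamma_functor F) mu (@gamma_eta F),
        let G : monad (vec F) := Monad monadG in
        [/\ is_differential_comonad (X := vec F) (S := G) d,
            is_Dlinear_unit (X := vec F) (S := G) d eps &
            exists cdcG : is_cartesian_differential
                            (op_kleisli_diff (X := vec F) (S := G) d),
              cat_isomorphic (Dlin (CartesianDifferential cdcG))
                             (cat_op (vec F))]).
Proof.
split=> [|mu d eps muP dP epsP].
  have [mu muP] := gamma_mu_exists F; have [d dP] := gamma_diff_exists F.
  by exists mu, d, (@gamma_eps F); split=> //; exact: gamma_epsP.
exists (gamma_monad muP) => /=.
have dG := gamma_differential muP dP; have eG := gamma_Dlinear_unit muP dP epsP.
split=> //; exists (op_kleisli_differential dG); exact: Dlin_op_kleisli eG _.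
Qed.
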